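(* Let $P=\{p_k\}_{k=1}^{\infty}$ be a Beurling generalized prime system with associated generalized integers $\{n_k\}_{k=1}^\infty$, and let $N(x)=\sum_{n_k<x}1$ and $\pi(x)=\sum_{p_k<x}1$. Suppose there is a constant $a>0$ such that $$\int_{1}^{\infty}\left|\frac{N(x)-ax}{x}\right|\frac{\mathrm{d}x}{x}<\infty$$ and $$N(x)=ax+O\left(\frac{x}{\log x}\right),\qquad x\to\infty.$$ Then $$\limsup_{x\to\infty}\frac{\pi(x)\log x}{x}<\infty .$$
   Context: A Beurling generalized prime system is a non-decreasing sequence of real numbers $1<p_1\le p_2\le\cdots$ with $p_k\to\infty$. Its generalized integers $\{n_k\}_{k=1}^\infty$ are the number $1$ together with all finite products $p_{k_1}p_{k_2}\cdots p_{k_m}$ of generalized primes (with $k_1\le k_2\le\dots\le k_m$), arranged in non-decreasing order and counted with multiplicity (i.e., each distinct multiset of indices gives one generalized integer). *)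

(* Defs.v *)
From HB Require Import structures.
From mathcomp Require Import all_boot all_order all_algebra.
From mathcomp Require Import all_classical all_reals all_analysis.

Set Implicit Arguments.
Unset Strict Implicit.
Unset Printing Implicit Defensive.

Import Order.TTheory GRing.Theory Num.Theory.
Import numFieldNormedType.Exports.

Local Open Scope classical_set_scope.
Local Open Scope ring_scope.

(* The [f = g +O_F h] notation looks up the filter structure of [F] canonically,
   and none is declared for the filter of neighbourhoods of +oo. *)
Canonical pinfty_filter_on (R : realType) :=
  FilterType (pinfty_nbhs R) (@filter_filter R _ (@proper_pinfty_nbhs R)).

(* Sequences are indexed from 0: [p k] and [n k] stand for p_{k+1} and
   n_{k+1}. *)
Definition beurling_primes (R : realType) (p : nat -> R) : Prop :=
  [/\ 1 < p 0%N, nondecreasing_seq p & p @ \oo --> +oo].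

(* A multiset of indices k_1 <= ... <= k_m is a sorted list; the empty list
   gives the generalized integer 1.  Since [e] is a bijection onto the sorted
   lists, [n] lists the products with multiplicity. *)
Definition generalized_integers (R : realType) (p n : nat -> R) : Prop :=
  nondecreasing_seq n /\
  exists e : nat -> seq nat,
    set_bij [set: nat] [set s | sorted leq s] e /\
    forall j, n j = \prod_(k <- e j) p k.

(* [\sum_(k \in A) _] is a finitely supported sum, with value 0 when the
   support is infinite; this default is never reached for a sequence that
   tends to infinity, as generalized primes and integers do. *)
Definition count_below (R : realType) (u : nat -> R) (x : R) : R :=
  \sum_(k \in [set k | u k < x]) (1 : R).

(* Main.v *)
Require Import Defs.
From HB Require Import structures.
From mathcomp Require Import all_boot all_order all_algebra.
From mathcomp Require Import all_classical all_reals all_analysis.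
From mathcomp Require Import measurable_realfun ring lra.
Import Order.TTheory GRing.Theory Num.Theory.
Import numFieldNormedType.Exports.
Local Open Scope classical_set_scope.
Local Open Scope ring_scope.

(** Write [N] for the counting function of the generalized integers,
    [E t = N t - a t], and let [Lambda] be the von Mangoldt weights of the prime
    powers, so that [Lambda * dN = log dN].  For the logistic bump
    [k w = e^w / (1 + e^w)^2] put
    [M x = sum_q Lambda q / q * k (eps * ln (x / q))].  Testing [dN] against the
    derivative [h'] of [h w = k (eps * w)] gives
    [sum_n h' (ln (x / n)) / n = a h (ln x) + O(eps h (ln x))
       + O(eps * int |E t| / t^2 * h (ln (x / t)) dt)],
    because [|k'|, |k''| <= 2 k].  Convolving with [Lambda] turns the left side
    into [sum_n ln n * h' (ln (x / n)) / n], which stays bounded: [h'] has mean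
    zero, and [E t = O(t / ln t)] absorbs the factor [ln n].  Hence
    [a M x <= O_eps(1) + a eps M x + O(eps) * int |E t| / t^2 * M (x / t) dt],
    and as [int |E t| / t^2 dt] is finite, a small [eps] lets the supremum of
    [M] over [(0, x]] be absorbed into the left side.  The bound on [M] gives
    [theta x = O(x)], hence the theorem. *)

(** * Limit superior and big-O at infinity *)

Lemma ereal_limf_esup_pinfty_lt (R : realType) (f : R -> R) (C x0 : R) :
  (forall x, x0 < x -> f x <= C) -> (limf_esup (fun x => (f x)%:E) +oo_R < +oo)%E.
Proof.
move=> fC; apply: (@le_lt_trans _ _ C%:E); last exact: ltry.
apply: le_trans; first apply: ereal_inf_lbound.
  by exists [set x | x0 < x] => //; exists x0; split => //; exact: num_real.
by apply: ge_ereal_sup => _ [x /= xx0 <-]; rewrite lee_fin fC.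
Qed.

Lemma bigO_pinfty_bound (R : realType) (f g h : R -> R)
  (hO : forall x : R, f x = g x +O_(x \near +oo_R) h x) :
  exists C X0 : R, 0 < C /\ forall x, X0 < x -> `|f x - g x| <= C * `|h x|.
Proof.
have /eqaddOP[M [_ H]] := funext hO.
have M1 : M < Num.max M 0 + 1.
  by rewrite (le_lt_trans (_ : M <= Num.max M 0)) ?le_max ?lexx// ltrDl.
have [X0 [_ HX]] := H _ M1.
exists (Num.max M 0 + 1), X0; split => //.
by rewrite ltr_wpDl// le_max lexx orbT.
Qed.

(** * Generalized integers *)

Lemma finite_seq_bounded (K L : nat) :
  finite_set [set s : seq nat | (size s <= L)%N /\ all (fun k => (k < K)%N) s].
Proof.
elim: L => [|L IH].
  apply: (@sub_finite_set _ _ [set [::]]); last exact: finite_set1.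
  by move=> s /= [+ _]; rewrite leqn0 size_eq0 => /eqP.
pose S := [set s : seq nat | (size s <= L)%N /\ all (fun k => (k < K)%N) s].
apply: (@sub_finite_set _ _ ([set [::]] `|` [set ks.1 :: ks.2 | ks in `I_K `*` S])).
  move=> [|k s] /=; first by left.
  by rewrite ltnS => -[sL /andP[kK aK]]; right; exists (k, s).
rewrite finite_setU; split; first exact: finite_set1.
by apply: finite_image; apply: finite_setX => //; exact: finite_II.
Qed.

(** Monotonicity makes the indices with [u j < x] an initial segment, whose length [J] is the least
    index with [x <= u J]. Being finite, it keeps the sum off its default value. *)
Lemma count_belowE (R : realType) (u : nat -> R) (x : R) :
  nondecreasing_seq u -> (exists j, x <= u j) ->
  exists J : nat, (forall j, (u j < x) = (j < J)%N) /\ count_below u x = J%:R.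
Proof.
move=> undec exu; have [J xJ minJ] := ex_minnP exu.
have uJ j : (u j < x) = (j < J)%N.
  apply/idP/idP => [|jJ].
    by apply: contraTT; rewrite -leqNgt -leNgt => /undec; exact: le_trans.
  by rewrite ltNge; apply/negP => /minJ; rewrite leqNgt jJ.
exists J; split => //; rewrite /count_below.
have -> : [set k | u k < x] = `I_J by apply/seteqP; split => j /=; rewrite uJ.
by rewrite -fsbig_ord sumr_const card_ord.
Qed.

Section BeurlingIntegers.
Variables (R : realType) (p : nat -> R).
Hypothesis hp : beurling_primes p.

Lemma beurling_prime_gt1 k : 1 < p k.
Proof. by have [p0 pnd _] := hp; rewrite (lt_le_trans p0) ?pnd. Qed.

Lemma beurling_prime_gt0 k : 0 < p k.
Proof. exact: lt_trans ltr01 (beurling_prime_gt1 k). Qed.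

Lemma beurling_prime_unbounded (x : R) : exists k, x <= p k.
Proof.
have [_ _ /cvgryPge/(_ x)[K _ HK]] := hp.
by exists K; apply: HK => /=.
Qed.

Lemma prod_beurling_ge1 (s : seq nat) : 1 <= \prod_(k <- s) p k.
Proof.
elim: s => [|k s IH]; rewrite ?big_nil ?big_cons//.
by rewrite mulr_ege1 // ltW // beurling_prime_gt1.
Qed.

(** A product below [x] uses only primes below [x], hence bounded indices, and its length is bounded
    through the Bernoulli-type estimate [size_le]. *)
Lemma finite_prod_beurling_lt (x : R) :
  finite_set [set s : seq nat | \prod_(k <- s) p k < x].
Proof.
have [K xK] := beurling_prime_unbounded x.
have p01 : 0 < p 0%N - 1 by rewrite subr_gt0 beurling_prime_gt1.
have [p0 pnd _] := hp.
have [L xL] : exists L : nat, x < 1 + (p 0%N - 1) * L%:R.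
  exists (Num.truncn `|x / (p 0%N - 1)|).+1.
  have := truncnS_gt (`|x / (p 0%N - 1)|).
  have xle := ler_norm (x / (p 0%N - 1)).
  move=> /(le_lt_trans xle); rewrite ltr_pdivrMr// mulrC => /lt_trans; apply.
  by rewrite ltrDr.
apply: sub_finite_set (finite_seq_bounded K L) => s /= sx.
have size_le (t : seq nat) : 1 + (p 0%N - 1) * (size t)%:R <= \prod_(k <- t) p k.
  elim: t => [|k t IH]; rewrite ?big_nil ?big_cons ?mulr0 ?addr0//=.
  have := prod_beurling_ge1 t; have := pnd _ _ (leq0n k).
  by rewrite -natr1; nra.
split.
  rewrite -(ler_nat R) -(ler_pM2l p01) -(lerD2l 1).
  by rewrite (le_trans (size_le s))// ltW// (lt_trans sx).
elim: s sx => //= k s IH; rewrite big_cons => sx.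
have := prod_beurling_ge1 s; have := beurling_prime_gt1 k => pk1 ps1.
rewrite IH ?andbT; last by nra.
by rewrite ltnNge; apply/negP => /pnd; nra.
Qed.

Variable n : nat -> R.
Hypothesis hn : generalized_integers p n.

Lemma beurling_integer_ge1 j : 1 <= n j.
Proof. by have [_ [e [_ ->]]] := hn; exact: prod_beurling_ge1. Qed.

(** If all generalized integers stayed below [x], the injective [e] would embed the naturals into
    the finite set of multisets with product below [x]. *)
Lemma beurling_integer_unbounded (x : R) : exists j, x <= n j.
Proof.
have [_ [e [ebij en]]] := hn; apply/not_existsP => H.
apply: infinite_nat.
have einj : injective e.
  by move=> i j eij; apply: (set_bij_inj ebij); rewrite ?inE.
apply: (@sub_finite_set _ _ (e @^-1` [set s | \prod_(k <- s) p k < x])).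
  by move=> j _ /=; rewrite -en ltNge; apply/negP/H.
apply: finite_preimage => [i j _ _|]; [exact: einj | exact: finite_prod_beurling_lt].
Qed.

Lemma beurling_integer_eq1 : exists j, n j = 1.
Proof.
have [_ [e [ebij en]]] := hn.
have [j _ ej] := set_bij_surj ebij (erefl : sorted leq [::]).
by exists j; rewrite en ej big_nil.
Qed.

End BeurlingIntegers.

(** * The von Mangoldt identity *)

(** Needed for surjectivity when all multisets are matched with those containing [k] at least [r]
    times. *)
Lemma perm_nseq_cat (T : eqType) (k : T) (r : nat) (s : seq T) :
  (r <= count_mem k s)%N -> exists t, perm_eq s (nseq r k ++ t).
Proof.
elim: r => [|r IH] rs; first by exists s.
have [t st] := IH (ltnW rs).
have kt : k \in t.
  move: rs; rewrite (permP st) count_cat count_nseq /= eqxx mul1n.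
  by rewrite -{1}(addn0 r) ltn_add2l -has_count has_pred1.
exists (rem k t); rewrite (perm_trans st)// -(addn1 r) nseqD.
by rewrite -catA perm_cat2l /= perm_to_rem.
Qed.

Lemma nneseries_pred1 (R : realType) (i : nat) (v : R) : 0 <= v ->
  (\sum_(k <oo) ((i == k)%:R * v)%:E = v%:E)%E.
Proof.
move=> v0; rewrite nneseries_esumT; last by move=> k; rewrite lee_fin mulr_ge0.
rewrite (_ : v%:E = \esum_(k in [set i]) (v%:E))%E; last by rewrite esum_set1 ?lee_fin.
rewrite [RHS]esum_mkcond; apply: eq_esum => k _.
have [->|ik] := eqVneq i k; first by rewrite mem_set// mul1r.
by rewrite memNset ?mul0r //= => ki; rewrite ki eqxx in ik.
Qed.

(** Counts the powers of one prime dividing a generalized integer, [c] being its multiplicity. *)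
Lemma nneseries_ltn (R : realType) (c : nat) (v : R) : 0 <= v ->
  (\sum_(r <oo) ((r < c)%N%:R * v)%:E = (c%:R * v)%:E)%E.
Proof.
move=> v0.
transitivity (\sum_(r <oo) \sum_(i < c) ((i == r :> nat)%:R * v)%:E)%E.
  apply: eq_eseriesr => r _; rewrite sumEFin -mulr_suml -natr_sum.
  congr ((_%:R * _)%:E); case: ltnP => rc.
    by rewrite (bigD1 (Ordinal rc))//= eqxx big1// => i /negbTE; rewrite -val_eqE/= => ->.
  rewrite big1// => i _; case: eqP => // ir.
  by have := ltn_ord i; rewrite ir ltnNge rc.
rewrite nneseries_sum; last by move=> *; rewrite lee_fin mulr_ge0.
under eq_bigr do rewrite nneseries_pred1//.
by rewrite sumEFin sumr_const card_ord mulr_natl.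
Qed.

Lemma count_mem_sum (s : seq nat) k :
  (count_mem k s = \sum_(i <- s) (i == k))%N.
Proof. by rewrite -sum1_count big_mkcond. Qed.

Section PrimePowers.
Variables (R : realType) (p n : nat -> R).
Hypotheses (hp : beurling_primes p) (hn : generalized_integers p n).

Let ln_p_ge0 k : 0 <= ln (p k).
Proof. by rewrite ln_ge0// ltW// beurling_prime_gt1. Qed.

(** The logarithm of a generalized integer is the sum over [k] of the multiplicity of [k] times
    [ln (p k)], and the multiplicity counts the [r] for which [k] occurs more than [r] times.
    Nonnegativity of [F] justifies every exchange of sums, infinite values included. *)
Lemma nneseries_beurling_prime_pow (F : R -> R) : (forall x, 0 <= F x) ->
  (\sum_(k <oo) \sum_(r <oo) \sum_(j <oo) (ln (p k) * F (p k ^+ r.+1 * n j))%:E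
   = \sum_(j <oo) (ln (n j) * F (n j))%:E)%E.
Proof.
move=> F0; have [_ [e [ebij en]]] := hn.
have einj : injective e by move=> i j; apply: (set_bij_inj ebij); rewrite inE.
have esrt j : sorted leq (e j).
  by have /= := set_bij_sub ebij; apply; exists j.
have /boolp.choice[inv invE] : forall s, exists j, e j = sort leq s.
  move=> s; have [j _ <-] := set_bij_surj ebij (sort_sorted leq_total s).
  by exists j.
have np (s : seq nat) j : perm_eq (e j) s -> n j = \prod_(k <- s) p k.
  by move=> es; rewrite en; exact: perm_big.
have shift k r : (\sum_(j <oo) (ln (p k) * F (p k ^+ r.+1 * n j))%:E =
    \sum_(j <oo) ((r < count_mem k (e j))%N%:R * (ln (p k) * F (n j)))%:E)%E.
  rewrite nneseries_esumT; last by move=> j; rewrite lee_fin mulr_ge0.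
  rewrite nneseries_esumT; last by move=> j; rewrite lee_fin !mulr_ge0.
  pose Q := [set j | (r < count_mem k (e j))%N].
  transitivity (\esum_(j in Q) (ln (p k) * F (n j))%:E)%E; last first.
    rewrite esum_mkcond; apply: eq_esum => j _.
    by case: ifPn; rewrite ?notin_setE ?inE /Q /= ; [move=> ->|move=> /negP/negbTE ->]; rewrite ?mul1r ?mul0r.
  (* Adding [r.+1] copies of [k] is a bijection from all multisets onto those
     containing [k] more than [r] times. *)
  pose tau j := inv (nseq r.+1 k ++ e j).
  have etau j : perm_eq (e (tau j)) (nseq r.+1 k ++ e j).
    by rewrite invE perm_sort.
  have taubij : set_bij [set: nat] Q tau.
    split.
    - move=> j _; rewrite /Q /= (permP (etau j)) count_cat count_nseq /=.
      by rewrite eqxx mul1n ltn_addr.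
    - move=> i j _ _ ij; apply: einj; apply: (sorted_eq leq_trans anti_leq) => //.
      rewrite -(perm_cat2l (nseq r.+1 k)) -(permPl (etau i)) perm_sym.
      by rewrite -(permPl (etau j)) ij.
    - move=> j Qj; have [t jt] := perm_nseq_cat _ _ _ _ Qj.
      exists (inv t) => //; apply: einj; apply: (sorted_eq leq_trans anti_leq) => //.
      rewrite (perm_trans (etau _))// perm_sym (perm_trans jt)// perm_cat2l invE.
      by rewrite perm_sym perm_sort.
  rewrite (reindex_esum _ _ _ _ taubij); apply: eq_esum => j _.
  by rewrite (np _ _ (etau j)) big_cat -en big_nseq iter_mulr_1.
under eq_eseriesr => k _.
  under eq_eseriesr => r _ do rewrite shift.
  rewrite nneseries_interchange; last by move=> *; rewrite lee_fin !mulr_ge0.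
  under eq_eseriesr => j _.
    rewrite nneseries_ltn; last by rewrite mulr_ge0.
    over.
  over.
rewrite nneseries_interchange; last by move=> *; rewrite lee_fin !mulr_ge0.
apply: eq_eseriesr => j _.
(* The multiplicity of [k] is a sum over the entries of [e j], so summing over [k] first leaves the
   sum of [ln (p i)] over these entries, which is [ln (n j)]. *)
transitivity (\sum_(k <oo) \sum_(i <- e j) ((i == k)%:R * (ln (p i) * F (n j)))%:E)%E.
  apply: eq_eseriesr => k _; rewrite count_mem_sum natr_sum mulr_suml -sumEFin.
  by apply: eq_bigr => i _; case: eqP => [->|]; rewrite ?mul0r.
rewrite nneseries_sum; last by move=> *; rewrite lee_fin !mulr_ge0.
under eq_bigr do rewrite nneseries_pred1 ?mulr_ge0//.
rewrite sumEFin -mulr_suml en; congr (_ * _)%:E.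
elim: (e j) => [|k s IH]; first by rewrite !big_nil ln1.
rewrite !big_cons IH lnM ?posrE ?beurling_prime_gt0//.
exact: lt_le_trans ltr01 (prod_beurling_ge1 _ _ hp s).
Qed.

(* [lam i] and [q i] enumerate the prime powers [q] with their weights
   [Lambda q], and the identity is [Lambda * dN = log dN]; [g] locates the
   primes among them. *)
Lemma beurling_von_mangoldt : exists lam q : nat -> R,
  [/\ forall i, 0 <= lam i, forall i, 1 <= q i,
      forall F : R -> R, (forall x, 1 <= x -> 0 <= F x) ->
        (\sum_(i <oo) \sum_(j <oo) (lam i * F (q i * n j))%:E
         = \sum_(j <oo) (ln (n j) * F (n j))%:E)%E
    & exists g : nat -> nat, [/\ injective g, forall k, q (g k) = p k
        & forall k, lam (g k) = ln (p k)]].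
Proof.
(* The pair [(k, r)] encodes the prime power [p k ^+ r.+1], of weight [ln (p k)]; [b] enumerates the
   pairs. *)
have /card_set_bijP[b bbij] : ([set: nat] #= [set: nat * nat])%card.
  by rewrite card_eq_sym; exact: card_nat2.
exists (fun i => ln (p (b i).1)), (fun i => p (b i).1 ^+ (b i).2.+1); split => //.
- by move=> i; rewrite exprn_ege1// ltW// beurling_prime_gt1.
(* Truncation at 0 gives a function nonnegative everywhere that agrees with [G] on [[1, +oo[], where
   all arguments lie. *)
- move=> G G0; pose F x := Num.max (G x) 0.
  have F0 x : 0 <= F x by rewrite le_max lexx orbT.
  have FE x : 1 <= x -> G x = F x by move=> /G0 Gx; rewrite /F max_l.
  have n1 := beurling_integer_ge1 _ _ hp _ hn.
  have qn1 i j : 1 <= p (b i).1 ^+ (b i).2.+1 * n j.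
    by rewrite mulr_ege1// exprn_ege1// ltW// beurling_prime_gt1.
  under [RHS]eq_eseriesr do rewrite FE//.
  under eq_eseriesr do under eq_eseriesr do rewrite FE//.
  rewrite -(nneseries_beurling_prime_pow F F0).
  rewrite nneseries_esumT; last first.
    by move=> i; apply: nneseries_ge0 => j _ _; rewrite lee_fin mulr_ge0.
  pose a (kr : nat * nat) :=
    (\sum_(j <oo) (ln (p kr.1) * F (p kr.1 ^+ kr.2.+1 * n j))%:E)%E.
  have a0 kr : (0 <= a kr)%E.
    by apply: nneseries_ge0 => j _ _; rewrite lee_fin mulr_ge0.
  rewrite -[LHS](reindex_esum _ _ _ a bbij).
  rewrite nneseries_esumT; last by move=> k; apply: nneseries_ge0 => r _ _; exact: (a0 (k, r)).
  under [RHS]eq_esum => k _.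
    rewrite nneseries_esumT; last by move=> r; exact: (a0 (k, r)).
    over.
  rewrite (@esum_esum _ _ _ _ _ (fun k r => a (k, r))); last by move=> *; exact: a0.
  rewrite (_ : _ `*`` _ = setT); last by apply/seteqP.
  by apply: eq_esum => -[].
- have /boolp.choice[g gE] : forall k, exists i, b i = (k, 0%N).
    by move=> k; have [i _ bi] := set_bij_surj bbij (I : [set: nat * nat] (k, 0%N)); exists i.
  exists g; split; last 2 first.
  + by move=> k; rewrite gE expr1.
  + by move=> k; rewrite gE.
  by move=> i j /(congr1 b); rewrite !gE => -[].
Qed.

End PrimePowers.

(** * Abel summation *)

Lemma is_derive_continuous (R : realType) (g : R -> R) (t d : R) :
  is_derive t 1 g d -> {for t, continuous g}.
Proof.
by move=> [gd _]; apply: differentiable_continuous; apply/derivable1_diffP.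
Qed.

Section IntegralPositive.
Variable R : realType.
Let mu := (@lebesgue_measure R).

Lemma within_continuous_pos (g : R -> R) (a b : R) : 0 < a ->
  (forall t : R, 0 < t -> {for t, continuous g}) -> {within `[a, b], continuous g}.
Proof.
move=> a0 cg; apply: continuous_in_subspaceT => t; rewrite inE/= in_itv/= => /andP[at_ _].
exact/cg/(lt_le_trans a0).
Qed.

Lemma integral_is_derive (g g' : R -> R) (a b : R) : 0 < a -> a <= b ->
  (forall t : R, 0 < t -> is_derive t 1 g (g' t)) ->
  (forall t : R, 0 < t -> {for t, continuous g'}) ->
  (\int[mu]_(t in `[a, b]) (g' t)%:E = (g b - g a)%:E)%E.
Proof.
move=> a0; rewrite le_eqVlt => /predU1P[<- _ _|ab dg cg'].
  by rewrite set_itv1 integral_set1 subrr.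
have cg t : 0 < t -> {for t, continuous g}.
  by move=> /dg; exact: is_derive_continuous.
have b0 : 0 < b by exact: lt_trans ab.
rewrite (continuous_FTC2 ab (F := g)) ?EFinB//.
- exact: within_continuous_pos.
- split.
  + move=> x; rewrite in_itv/= => /andP[ax _].
    by have [] := dg _ (lt_trans a0 ax).
  + exact/cvg_at_right_filter/cg.
  + exact/cvg_at_left_filter/cg.
- move=> x; rewrite in_itv/= => /andP[ax _]; rewrite derive1E.
  by have [_ ->] := dg _ (lt_trans a0 ax).
Qed.

Lemma integrable_continuous_pos (g : R -> R) (a b : R) : 0 < a ->
  (forall t : R, 0 < t -> {for t, continuous g}) ->
  mu.-integrable `[a, b] (EFin \o g).
Proof.
move=> a0 cg; apply: continuous_compact_integrable; first exact: segment_compact.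
exact: within_continuous_pos.
Qed.

Lemma integrable_continuous_indic (g : R -> R) (a b v : R) : 0 < a ->
  (forall t : R, 0 < t -> {for t, continuous g}) ->
  mu.-integrable `[a, b] (EFin \o (fun t => g t * (v < t)%R%:R)).
Proof.
move=> a0 cg; have ig := integrable_continuous_pos g a b a0 cg.
have mD : measurable (`[a, b] : set R) by exact: measurable_itv.
apply: (@le_integrable _ _ _ mu _ mD _ (EFin \o g)) => //.
  apply/measurable_EFinP; apply: measurable_funM.
    by apply/measurable_EFinP; exact: (measurable_int mu ig).
  rewrite (_ : (fun t => _) = \1_(`]v, +oo[)); first exact: measurable_indic.
  by apply/funext => t; rewrite indicE mem_setE in_itv/= andbT.
move=> t _; rewrite /= lee_fin normrM ler_piMr//.
by case: (v < t); rewrite ?normr1 ?normr0.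
Qed.

(** The contribution of a single term [v] to Abel summation: the indicator cuts the domain down to
    []v, b]], where the fundamental theorem of calculus applies. *)
Lemma integral_is_derive_indic (g g' : R -> R) (a b v : R) : 0 < a -> a <= v <= b ->
  (forall t : R, 0 < t -> is_derive t 1 g (g' t)) ->
  (forall t : R, 0 < t -> {for t, continuous g'}) ->
  (\int[mu]_(t in `[a, b]) (g' t * (v < t)%R%:R)%:E = (g b - g v)%:E)%E.
Proof.
move=> a0 /andP[av vb] dg cg'; have v0 : 0 < v by exact: lt_le_trans av.
rewrite -(integral_is_derive g g' v b)// -(integral_itv_obnd_cbnd (r := v)); last first.
  have mg := measurable_int mu (integrable_continuous_pos g' v b v0 cg').
  by apply: (measurable_funS _ _ mg) => //; exact: subset_itv_oc_cc.
rewrite (_ : `]v, b] = `[a, b] `&` `]v, +oo[)%classic; last first.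
  apply/seteqP; split => t /=; rewrite !in_itv/= ?andbT.
    by move=> /andP[vt tb]; rewrite vt tb (le_trans av (ltW vt)).
  by move=> [/andP[_ ->] ->].
rewrite integral_mkcondr; apply: eq_integral => t _.
rewrite patchE mem_setE in_itv/= andbT.
by case: (v < t); rewrite ?mulr1 ?mulr0.
Qed.

(* The main term [a * \int f] is expressed through the antiderivative [Phi]. *)
Lemma abel_summation (u : nat -> R) (a : R) (Phi f f' : R -> R) (X : R) (J : nat) :
  nondecreasing_seq u -> (forall j, 1 <= u j) -> (forall x, exists j, x <= u j) ->
  (forall j, (u j < X) = (j < J)%N) -> 1 <= X ->
  (forall t : R, 0 < t -> is_derive t 1 Phi (f t)) ->
  (forall t : R, 0 < t -> is_derive t 1 f (f' t)) ->
  (forall t : R, 0 < t -> {for t, continuous f'}) ->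
  (`|\sum_(j < J) f (u j) - (J%:R - a * X) * f X - a * f 1 - a * (Phi X - Phi 1)|%:E
   <= \int[mu]_(t in `[1%R, X]) (`|f' t| * `|count_below u t - a * t|)%:E)%E.
Proof.
move=> und u1 uoo uJ X1 dPhi df cf'.
have mD : measurable (`[1, X] : set R) by exact: measurable_itv.
(* Up to the cutoff [X] only the first [J] terms can be counted, so the counting function is a
   finite sum of indicators there. *)
have cu t : count_below u t = \sum_(j < J) (u j < t)%R%:R \/ X < t.
  have [tX|] := leP t X; [left|by right].
  have [K [uK ->]] := count_belowE _ u t und (uoo t).
  under eq_bigr do rewrite uK.
  have KJ : (K <= J)%N.
    rewrite leqNgt; apply/negP; rewrite -uK => uJt.
    by have := lt_le_trans uJt tX; rewrite uJ ltnn.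
  rewrite -natr_sum; congr _%:R; rewrite -big_mkcond/= -(big_ord_widen _ (fun=> 1%N) KJ).
  by rewrite sum1_card card_ord.
have dg (t : R) : 0 < t -> is_derive t 1 (fun t => t * f t - Phi t) (t * f' t).
  move=> t0; have := dPhi _ t0; have := df _ t0 => ? ?.
  by apply: is_derive_eq; rewrite /GRing.scale/= mulr1; ring.
have cg (t : R) : 0 < t -> {for t, continuous (fun t : R => t * f' t)}.
  by move=> t0; apply: cvgM; [exact: cvg_id | exact: cf'].
have i1 (j : 'I_J) := integral_is_derive_indic f f' 1 X (u j) ltr01.
have i2 := integral_is_derive _ _ 1 X ltr01 X1 dg cg.
have igj (j : 'I_J) := integrable_continuous_indic f' 1 X (u j) ltr01 cf'.
have ig := integrable_continuous_pos _ 1 X ltr01 cg.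
have iS : mu.-integrable `[1, X] (EFin \o (fun t => \sum_(j < J) f' t * (u j < t)%R%:R)).
  rewrite (_ : _ \o _ = fun t => (\sum_(j < J) (f' t * (u j < t)%R%:R)%:E)%E).
    exact: (@integrable_sum _ _ _ mu _ mD _ (index_enum 'I_J) xpredT
      (fun j => EFin \o (fun t => f' t * (u j < t)%R%:R)) (fun j _ => igj j)).
  by apply/funext => t; rewrite /= sumEFin.
have iG : mu.-integrable `[1, X] (EFin \o (fun t => a * (t * f' t))).
  exact: (@integrableZl _ _ _ mu _ mD a _ ig).
pose G t := \sum_(j < J) f' t * (u j < t)%R%:R - a * (t * f' t).
have GE t : t \in `[1, X]%classic -> G t = f' t * (count_below u t - a * t).
  rewrite inE/= in_itv/= => /andP[_ tX]; case: (cu t) => [->|]; last by rewrite ltNge tX.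
  by rewrite /G -mulr_sumr; ring.
(* Each [j < J] contributes [f X - f (u j)]; the main term uses the antiderivative [t * f t - Phi t]
   of [t * f' t]. *)
have intG : (\int[mu]_(t in `[1%R, X]) (G t)%:E)%E =
    (- (\sum_(j < J) f (u j) - (J%:R - a * X) * f X - a * f 1 - a * (Phi X - Phi 1)))%:E.
  transitivity (\int[mu]_(t in `[1%R, X]) (\sum_(j < J) f' t * (u j < t)%R%:R)%:E
      - \int[mu]_(t in `[1%R, X]) (a * (t * f' t))%:E)%E.
    rewrite -[RHS](@integralB_EFin _ _ _ mu _ _ _ mD iS iG).
    by apply: eq_integral => t _; rewrite /G EFinB.
  rewrite (_ : (\int[mu]_(t in _) (\sum_(j < J) _)%:E)%E = (\sum_(j < J) (f X - f (u j)))%:E); last first.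
    under eq_integral do rewrite -sumEFin.
    rewrite (@integral_sum _ _ _ mu _ mD _ _ igj) -sumEFin; apply: eq_bigr => j _.
    by rewrite /= i1// u1/= ltW// uJ.
  under [X in (_ - X)%E]eq_integral do rewrite EFinM.
  rewrite (@integralZl _ _ _ mu _ mD _ ig) /= i2 -EFinM -EFinB; congr _%:E.
  by rewrite sumrB sumr_const card_ord -mulr_natl; ring.
apply: (@le_trans _ _ (`|\int[mu]_(t in `[1%R, X]) (G t)%:E|)%E).
  by rewrite intG /= normrN.
apply: le_trans (le_abse_integral mu mD _) _.
  by apply: measurable_int; apply: @integrableB _ _ _ mu _ mD _ _ iS iG.
rewrite (_ : (\int[mu]_(x in _) `|_|)%E = (\int[mu]_(t in `[1%R, X]) (`|f' t| * `|count_below u t - a * t|)%:E)%E)//.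
by apply: eq_integral => t tD; rewrite GE// -normrM.
Qed.

End IntegralPositive.

(** * The logistic kernel *)

Section LogisticKernel.
Variables (R : realType) (eps : R).

(* As functions of [t] at the multiplicative scale [x = exp c]: [kernel c t] is
   [k (eps * (c - ln t))], and [dkernel], [ddkernel] are its first two
   derivatives with respect to [c]. *)
Definition logistic (c t : R) : R := (1 + expR (eps * (ln t - c)))^-1.

Definition kernel (c t : R) : R := logistic c t * (1 - logistic c t).

Let denom_gt0 c t : 0 < 1 + expR (eps * (ln t - c)).
Proof. by rewrite addr_gt0// expR_gt0. Qed.

Lemma logistic_gt0 (c t : R) : 0 < logistic c t.
Proof. by rewrite invr_gt0. Qed.

Lemma logistic_lt1 (c t : R) : logistic c t < 1.
Proof. by rewrite invf_lt1// ltrDl expR_gt0. Qed.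

Lemma kernel_gt0 (c t : R) : 0 < kernel c t.
Proof. by rewrite mulr_gt0 ?logistic_gt0// subr_gt0 logistic_lt1. Qed.

Lemma kernel_le1 (c t : R) : kernel c t <= 1.
Proof.
by rewrite /kernel; have := logistic_gt0 c t; have := logistic_lt1 c t; nra.
Qed.

Lemma kernelE (c t : R) :
  kernel c t = expR (eps * (ln t - c)) / (1 + expR (eps * (ln t - c))) ^+ 2.
Proof. by rewrite /kernel /logistic; field; rewrite gt_eqF. Qed.

(** With [E = exp (eps * (ln t - c))] this is [E / (1 + E)^2 <= 1 / E]. The resulting decay in [t]
    serves for convergence and for boundary terms at infinity. *)
Lemma kernel_le_expR (c t : R) : kernel c t <= expR (- (eps * (ln t - c))).
Proof.
rewrite kernelE expRN; have := expR_gt0 (eps * (ln t - c)).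
set E := expR _ => E0; have D0 : 0 < 1 + E by lra.
by rewrite ler_pdivrMr ?exprn_gt0// mulrC ler_pdivlMr//; nra.
Qed.

(** For [ln t <= c] the exponential [E] is at most 1, so the denominator [(1 + E)^2] is at most 4.
    This lower bound leads from the mean back to a sum over primes. *)
Lemma kernel_ge_expR (c t : R) : 0 < eps -> ln t <= c ->
  expR (eps * (ln t - c)) <= 4 * kernel c t.
Proof.
move=> eps0 tc; rewrite kernelE; have := expR_gt0 (eps * (ln t - c)).
have : expR (eps * (ln t - c)) <= 1.
  by rewrite -[leRHS]expR0 ler_expR pmulr_rle0// subr_le0.
set E := expR _ => E1 E0; have D0 : 0 < 1 + E by lra.
by rewrite mulrA ler_pdivlMr ?exprn_gt0//; nra.
Qed.

(** Multiplication of the argument by [q] is a shift of the logarithmic scale by [ln q]. *)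
Lemma kernel_shift (c q t : R) : 0 < q -> 0 < t -> kernel (c - ln q) t = kernel c (q * t).
Proof.
move=> q0 t0; rewrite /kernel /logistic lnM ?posrE//.
by rewrite (_ : ln t - (c - ln q) = ln q + ln t - c)//; ring.
Qed.

Lemma logistic_shift (c q t : R) : 0 < q -> 0 < t ->
  logistic (c - ln q) t = logistic c (q * t).
Proof.
move=> q0 t0; rewrite /logistic lnM ?posrE//.
by rewrite (_ : ln t - (c - ln q) = ln q + ln t - c)//; ring.
Qed.

Lemma is_derive_logistic (c t : R) : 0 < t ->
  is_derive t 1 (logistic c) (- (eps * kernel c t / t)).
Proof.
move=> t0; have dln := is_derive1_ln t0.
have dE : is_derive t 1 (fun t => expR (eps * (ln t - c)))
    (expR (eps * (ln t - c)) * (eps * t^-1)).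
  apply: (@is_derive1_comp _ expR (fun t => eps * (ln t - c))).
  by apply: is_derive_eq; rewrite /GRing.scale/=; ring.
have dD : is_derive t 1 (fun t => 1 + expR (eps * (ln t - c)))
    (expR (eps * (ln t - c)) * (eps * t^-1)).
  by apply: is_derive_eq; rewrite add0r mul1r.
have := @is_deriveV _ (fun t => 1 + expR (eps * (ln t - c))) t _ _ (lt0r_neq0 (denom_gt0 c t)) dD.
move=> /is_derive_eq; apply; rewrite /GRing.scale/= kernelE.
by field; rewrite gt_eqF//= gt_eqF.
Qed.

Definition dkernel (c t : R) : R := eps * kernel c t * (1 - 2 * logistic c t).

Definition ddkernel (c t : R) : R :=
  eps ^+ 2 * (kernel c t * (1 - 2 * logistic c t) ^+ 2 - 2 * kernel c t ^+ 2).

Lemma is_derive_kernel (c t : R) : 0 < t ->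
  is_derive t 1 (kernel c) (- (dkernel c t / t)).
Proof.
move=> t0; have ds := is_derive_logistic c t t0.
rewrite /kernel; apply: is_derive_eq; rewrite /GRing.scale/= /dkernel /kernel.
by field; rewrite gt_eqF.
Qed.

Lemma is_derive_dkernel (c t : R) : 0 < t ->
  is_derive t 1 (dkernel c) (- (ddkernel c t / t)).
Proof.
move=> t0; have ds := is_derive_logistic c t t0.
have dk := is_derive_kernel c t t0.
rewrite /dkernel; apply: is_derive_eq; rewrite /GRing.scale/= /dkernel /ddkernel.
by field; rewrite gt_eqF.
Qed.

Lemma continuous_dkernel (c t : R) : 0 < t -> {for t, continuous (dkernel c)}.
Proof. by move=> /(is_derive_dkernel c); exact: is_derive_continuous. Qed.

Lemma continuous_kernel (c t : R) : 0 < t -> {for t, continuous (kernel c)}.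
Proof. by move=> /(is_derive_kernel c); exact: is_derive_continuous. Qed.

Lemma continuous_ddkernel (c t : R) : 0 < t -> {for t, continuous (ddkernel c)}.
Proof.
move=> t0; have ds := is_derive_logistic c t t0.
have dk := is_derive_kernel c t t0.
suff [d dd] : exists d, is_derive t 1 (ddkernel c) d.
  exact: is_derive_continuous dd.
by rewrite /ddkernel; eexists; apply: is_deriveM.
Qed.

Hypotheses (eps0 : 0 < eps) (eps1 : eps <= 1).

(** The factor [1 - 2 * logistic] has modulus below 1. The derivative is thus dominated by the
    kernel itself with a gain of [eps], which later permits absorption. *)
Lemma norm_dkernel_le (c t : R) : `|dkernel c t| <= eps * kernel c t.
Proof.
have ek : 0 < eps * kernel c t by rewrite mulr_gt0// kernel_gt0.
rewrite /dkernel normrM (gtr0_norm ek) ler_piMr ?(ltW ek)//.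
rewrite ler_norml; have := logistic_gt0 c t; have := logistic_lt1 c t.
by move=> *; apply/andP; split; lra.
Qed.

(** The bracket lies between [- 2 * kernel] and [kernel], because [(1 - 2 * logistic)^2] and
    [kernel] are at most 1; one of the two factors [eps] is given up through [eps <= 1]. *)
Lemma norm_ddkernel_le (c t : R) : `|ddkernel c t| <= 2 * (eps * kernel c t).
Proof.
rewrite /ddkernel normrM (gtr0_norm (exprn_gt0 2 eps0)) expr2 -mulrA [leRHS]mulrCA.
rewrite (ler_pM2l eps0).
have k0 := kernel_gt0 c t; have s0 := logistic_gt0 c t; have s1 := logistic_lt1 c t.
have k1 := kernel_le1 c t.
have : `|kernel c t * (1 - 2 * logistic c t) ^+ 2 - 2 * kernel c t ^+ 2| <= 2 * kernel c t.
  move: k1 k0; set k := kernel c t => k1 k0; rewrite ler_norml; apply/andP; split.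
    have : 0 <= (1 - 2 * logistic c t) ^+ 2 by exact: sqr_ge0.
    by set z := _ ^+ 2 => z0; nra.
  have : (1 - 2 * logistic c t) ^+ 2 <= 1 by nra.
  by set z := _ ^+ 2 => z1; nra.
by move=> H; rewrite (le_trans _ H)// ler_piMl.
Qed.

End LogisticKernel.

(** * Sums over generalized integers *)

Lemma nneseries_EFin_le (R : realType) (f : nat -> R) (B : \bar R) :
  (forall j, 0 <= f j) -> (forall J, ((\sum_(j < J) f j)%:E <= B)%E) ->
  (\sum_(j <oo) (f j)%:E <= B)%E.
Proof.
move=> f0 fB; apply: lime_le.
  by apply: is_cvg_nneseries => j _ _; rewrite lee_fin.
by apply: nearW => J; rewrite sumEFin big_mkord.
Qed.

Lemma nneseries_EFin_ge (R : realType) (f : nat -> R) (J : nat) :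
  (forall j, 0 <= f j) -> ((\sum_(j < J) f j)%:E <= \sum_(j <oo) (f j)%:E)%E.
Proof.
move=> f0; rewrite -sumEFin -(big_mkord xpredT (fun j => (f j)%:E)).
by apply: nneseries_lim_ge => j _ _; rewrite lee_fin.
Qed.

Lemma measurable_continuous_pos (R : realType) (g : R -> R) (D : set R) :
  measurable D -> (forall t, D t -> 0 < t) ->
  (forall t : R, 0 < t -> {for t, continuous g}) -> measurable_fun D g.
Proof.
move=> mD D0 cg; apply: subspace_continuous_measurable_fun => //.
by apply: continuous_in_subspaceT => t; rewrite inE => /D0; exact: cg.
Qed.

Lemma sum_ord_le (R : realType) (f : nat -> R) (J K : nat) : (J <= K)%N ->
  (forall j, 0 <= f j) -> \sum_(j < J) f j <= \sum_(j < K) f j.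
Proof.
by move=> JK f0; rewrite (big_ord_widen _ f JK) big_mkcond/= ler_sum// => j _; case: ifP.
Qed.

Section CountingError.
Variables (R : realType) (u : nat -> R) (a C : R).
Hypotheses (und : nondecreasing_seq u) (u1 : forall j, 1 <= u j)
  (uoo : forall x, exists j, x <= u j).

Let mu := (@lebesgue_measure R).

(** Supplies cutoffs for Abel summation arbitrarily far out and beyond any prescribed number of
    terms. *)
Lemma count_below_exists (J0 : nat) (X0 : R) : exists X J,
  [/\ X0 <= X, 1 <= X, (J0 <= J)%N, forall j, (u j < X) = (j < J)%N
    & count_below u X = J%:R].
Proof.
pose X := Num.max X0 (u J0 + 1); have [J [uJ cJ]] := count_belowE _ u X und (uoo X).
have uX : u J0 + 1 <= X by rewrite le_max lexx orbT.
exists X, J; split => //.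
- by rewrite le_max lexx.
- by have := u1 J0; lra.
- by apply: ltnW; rewrite -uJ; lra.
Qed.

Lemma measurable_count_below (D : set R) : measurable D -> measurable_fun D (count_below u).
Proof.
move=> mD; apply: nondecreasing_measurable => // x y xy.
have [J [uJ ->]] := count_belowE _ u x und (uoo x).
have [K [uK ->]] := count_belowE _ u y und (uoo y).
rewrite ler_nat leqNgt; apply/negP; rewrite -uJ => uKx.
by have := lt_le_trans uKx xy; rewrite uK ltnn.
Qed.

Hypotheses (a0 : 0 <= a) (C0 : 0 <= C)
  (hC : forall t, 1 <= t -> `|count_below u t - a * t| <= C * (t / (1 + ln t))).

Lemma measurable_norm_mul (f' : R -> R) (D : set R) : measurable D ->
  (forall t, D t -> 0 < t) -> (forall t : R, 0 < t -> {for t, continuous f'}) ->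
  measurable_fun D (fun t => (`|f' t| * `|count_below u t - a * t|)%:E).
Proof.
move=> mD D0 cf'; apply/measurable_EFinP; apply: measurable_funM.
  by apply: measurableT_comp => //; exact: measurable_continuous_pos.
apply: measurableT_comp => //; apply: measurable_funB; first exact: measurable_count_below.
by apply: measurable_funM.
Qed.

Lemma integral_error_le_is_derive (f' g g' : R -> R) (X : R) : 1 <= X ->
  (forall t : R, 0 < t -> {for t, continuous f'}) ->
  (forall t : R, 0 < t -> is_derive t 1 g (g' t)) ->
  (forall t : R, 0 < t -> {for t, continuous g'}) ->
  (forall t, 1 <= t -> `|f' t| * `|count_below u t - a * t| <= g' t) ->
  (\int[mu]_(t in `[1%R, X]) (`|f' t| * `|count_below u t - a * t|)%:E
   <= (g X - g 1)%:E)%E.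
Proof.
move=> X1 cf' dg cg' fg.
rewrite -(integral_is_derive _ g g' 1 X ltr01 X1 dg cg').
have mD : measurable (`[1, X]%classic : set R) by exact: measurable_itv.
have D0 t : `[1, X]%classic t -> 0 < t by rewrite /= in_itv/= => /andP[t1 _]; lra.
apply: ge0_le_integral => //.
- exact: measurable_norm_mul.
- by apply/measurable_EFinP; exact: measurable_continuous_pos.
- by move=> t /=; rewrite in_itv/= => /andP[t1 _]; rewrite lee_fin fg.
Qed.

Lemma count_error_le (t : R) : 1 <= t -> `|count_below u t - a * t| <= C * t.
Proof.
move=> t1; apply: (le_trans (hC _ t1)); rewrite ler_wpM2l//.
have := ln_ge0 t1 => lt0; rewrite ler_pdivrMr; [nra | lra].
Qed.

(** The summand is [u j] to the power [- (1 + d)]. Abel summation with the crude error [C * t]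
    reduces the sum to integrals of [t ^ (- 1 - d)], convergent as [d > 0]. *)
Lemma sum_power_bounded (d : R) : 0 < d ->
  exists B : R, forall J, \sum_(j < J) expR (- (d * ln (u j))) / u j <= B.
Proof.
move=> d0; pose w t := expR (- (d * ln t)).
have w0 t : 0 < w t by exact: expR_gt0.
have w1 t : 1 <= t -> w t <= 1.
  move=> /ln_ge0 lt0; rewrite /w -[leRHS]expR0 ler_expR oppr_le0 mulr_ge0// ltW//.
have dw (t : R) : 0 < t -> is_derive t 1 w (- (d * w t / t)).
  move=> t0; have dln := is_derive1_ln t0.
  have dE : is_derive t 1 (fun t => - (d * ln t)) (- (d * t^-1)).
    by apply: is_derive_eq; rewrite /GRing.scale/=; ring.
  have := @is_derive1_comp _ expR (fun t => - (d * ln t)) t _ _ (is_derive_expR _) dE.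
  by move=> /is_derive_eq; apply; rewrite /w; ring.
have cw (t : R) : 0 < t -> {for t, continuous w}.
  by move=> /dw; exact: is_derive_continuous.
have cV (t : R) : 0 < t -> {for t, continuous (fun t : R => t^-1)}.
  by move=> t0; apply: inv_continuous; rewrite gt_eqF.
pose Phi t := - (w t / d).
pose f t := w t * t^-1.
pose f' t := - ((1 + d) * w t * t^-1 * t^-1).
have dPhi (t : R) : 0 < t -> is_derive t 1 Phi (f t).
  move=> t0; have ? := dw _ t0; rewrite /Phi; apply: is_derive_eq.
  by rewrite /GRing.scale/= /f; field; rewrite !gt_eqF.
have df (t : R) : 0 < t -> is_derive t 1 f (f' t).
  move=> t0; have ? := dw _ t0; have t0' := lt0r_neq0 t0.
  have ? : is_derive t 1 (fun t : R => t^-1) (- t ^- 2).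
    by have := @is_deriveV _ id t 1 1 t0' (is_derive_id t 1) => /is_derive_eq; apply; rewrite /GRing.scale/= mulr1.
  rewrite /f; apply: is_derive_eq.
  by rewrite /GRing.scale/= /f'; field; rewrite gt_eqF.
have cf' (t : R) : 0 < t -> {for t, continuous f'}.
  move=> t0; apply: cvgN; apply: cvgM (cV _ t0); apply: cvgM (cV _ t0).
  by apply: cvgM (cw _ t0); exact: cvg_cst.
pose g t := C * (1 + d) * - (w t / d).
pose g' t := C * (1 + d) * (w t * t^-1).
have dg (t : R) : 0 < t -> is_derive t 1 g (g' t).
  move=> t0; have ? := dPhi _ t0; rewrite /g -/(Phi _); apply: is_derive_eq.
  by rewrite /GRing.scale/= /g' /f; ring.
have cg' (t : R) : 0 < t -> {for t, continuous g'}.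
  move=> t0; apply: cvgM; first exact: cvg_cst.
  by apply: cvgM (cV _ t0); exact: cw.
(* The four terms bound, in order, the boundary term at [X], the boundary term [a * f 1], the main
   term and the error integral. *)
exists (C + a + a / d + C * (1 + d) / d) => J0.
have [X [J [_ X1 J0J uJ cJ]]] := count_below_exists J0 1.
apply: (@le_trans _ _ (\sum_(j < J) f (u j))).
  apply: (sum_ord_le _ (fun j => f (u j))) => // j.
  by rewrite mulr_ge0 ?ltW// invr_gt0; have := u1 j; lra.
have := abel_summation _ u a Phi f f' X J und u1 uoo uJ X1 dPhi df cf'.
have fg t : 1 <= t -> `|f' t| * `|count_below u t - a * t| <= g' t.
  move=> t1; have t0 : 0 < t by lra.
  rewrite /f' normrN gtr0_norm; last by rewrite !mulr_gt0 ?invr_gt0//; lra.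
  apply: le_trans (ler_wpM2l _ (count_error_le _ t1)) _.
    by rewrite ltW// !mulr_gt0 ?invr_gt0//; lra.
  by rewrite le_eqVlt /g'; apply/orP; left; apply/eqP; field; rewrite gt_eqF.
move=> /le_trans/(_ (integral_error_le_is_derive f' g g' X X1 cf' dg cg' fg)).
rewrite lee_fin => /ler_normlP[_]; rewrite !lerBlDr => /le_trans; apply.
have X0 : 0 < X by lra.
have E1 : (J%:R - a * X) * f X <= C.
  have := count_error_le _ X1; rewrite cJ => JX.
  have fX0 : 0 <= f X by rewrite /f mulr_ge0 ?ltW// invr_gt0.
  apply: le_trans (ler_wpM2r fX0 (le_trans (ler_norm _) JX)) _.
  rewrite /f (_ : C * X * _ = C * w X); last by field; rewrite gt_eqF.
  by rewrite ler_piMr// w1.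
have f1 : f 1 = 1 by rewrite /f /w ln1 mulr0 oppr0 expR0 invr1 mulr1.
have wd0 t : 0 <= w t / d by rewrite divr_ge0// ltW.
have E2 : Phi X - Phi 1 <= d^-1.
  by rewrite /Phi {2}/w ln1 mulr0 oppr0 expR0 div1r opprK gerDr oppr_le0.
have E3 : g X - g 1 <= C * (1 + d) / d.
  rewrite (_ : g X - g 1 = C * (1 + d) * (Phi X - Phi 1)); last by rewrite mulrBr.
  by rewrite ler_wpM2l// mulr_ge0//; lra.
have E4 := ler_wpM2l a0 E2.
by rewrite f1; lra.
Qed.

End CountingError.

Section KernelSums.
Variables (R : realType) (u : nat -> R) (a C eps : R).
Hypotheses (und : nondecreasing_seq u) (u1 : forall j, 1 <= u j)
  (uoo : forall x, exists j, x <= u j).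
Hypotheses (a0 : 0 <= a) (C0 : 0 <= C)
  (hC : forall t, 1 <= t -> `|count_below u t - a * t| <= C * (t / (1 + ln t))).
Hypotheses (eps0 : 0 < eps) (eps1 : eps <= 1).

Let mu := (@lebesgue_measure R).

(* The signed sum over [dkernel] is split as [pos_part - neg_part] so that all
   series can be rearranged as nonnegative extended real series. *)
Definition pos_part (c t : R) : R := eps * kernel R eps c t * (1 - logistic R eps c t).
Definition neg_part (c t : R) : R := eps * kernel R eps c t * logistic R eps c t.

Lemma dkernelE c t : dkernel R eps c t = pos_part c t - neg_part c t.
Proof. by rewrite /dkernel /pos_part /neg_part; ring. Qed.

Lemma pos_part_ge0 c t : 0 <= pos_part c t.
Proof.
apply: mulr_ge0; first by apply/mulr_ge0/ltW/kernel_gt0; exact: ltW.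
by rewrite subr_ge0 ltW// logistic_lt1.
Qed.

Lemma neg_part_ge0 c t : 0 <= neg_part c t.
Proof.
apply/mulr_ge0/ltW/logistic_gt0; apply/mulr_ge0/ltW/kernel_gt0; exact: ltW.
Qed.

Lemma neg_part_le c t : neg_part c t <= expR (eps * c) * expR (- (eps * ln t)).
Proof.
have k0 := kernel_gt0 R eps c t.
apply: (@le_trans _ _ (kernel R eps c t)).
  have ek : 0 <= eps * kernel R eps c t by apply/mulr_ge0/ltW/k0; exact: ltW.
  apply: le_trans (ler_piMr ek (ltW (logistic_lt1 R eps c t))) _.
  by rewrite ler_piMl// ltW.
apply: le_trans (kernel_le_expR _ _ _ _) _.
by rewrite -expRD mulrBr opprB.
Qed.

Let cV (t : R) : 0 < t -> {for t, continuous (fun t : R => t^-1)}.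
Proof. by move=> t0; apply: inv_continuous; rewrite gt_eqF. Qed.

Let dV (t : R) : 0 < t -> is_derive t 1 (fun t : R => t^-1) (- t ^- 2).
Proof.
move=> t0; have := @is_deriveV _ id t 1 1 (lt0r_neq0 t0) (is_derive_id t 1).
by move=> /is_derive_eq; apply; rewrite /GRing.scale/= mulr1.
Qed.

Lemma norm_dkernel_ddkernel_le c t :
  `|dkernel R eps c t| + `|ddkernel R eps c t| <= 3 * (eps * kernel R eps c t).
Proof.
have := norm_dkernel_le R eps eps0 c t; have := norm_ddkernel_le R eps eps0 eps1 c t.
by lra.
Qed.

Lemma kernel_lt_exists c (d : R) : 0 < d ->
  exists X0, forall X, X0 <= X -> kernel R eps c X < d.
Proof.
(* From here on [eps * (ln X - c) >= 1 - ln d], so the exponential bound is at most [d / e]. *)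
move=> d0; exists (expR (c + (1 - ln d) / eps)) => X XX.
have X0 : 0 < X by apply: lt_le_trans XX; exact: expR_gt0.
apply: le_lt_trans (kernel_le_expR _ _ _ _) _.
rewrite -[ltRHS]lnK ?posrE// ltr_expR.
have : c + (1 - ln d) / eps <= ln X by rewrite -ler_expR lnK ?posrE.
rewrite -lerBrDl ler_pdivrMr// mulrC; lra.
Qed.

Lemma continuous_sum_dkernel c (t : R) : 0 < t ->
  {for t, continuous (fun t => dkernel R eps c t + ddkernel R eps c t)}.
Proof.
by move=> t0; apply: cvgD; [exact: continuous_dkernel | exact: continuous_ddkernel].
Qed.

(** Abel summation for [f t = dkernel / t], whose antiderivative [- kernel] produces the main term
    [a * kernel c 1] as the cutoff tends to infinity. The value [f 1] costs [a * eps * kernel c 1],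
    and the bound [3 * eps * kernel] on the two derivatives controls the error integral. The
    negative parts stand on the left so that all terms are nonnegative. *)
Lemma kernel_le_sum (c : R) :
  ((a * kernel R eps c 1)%:E + \sum_(j <oo) (neg_part c (u j) / u j)%:E
   <= \sum_(j <oo) (pos_part c (u j) / u j)%:E + (a * eps * kernel R eps c 1)%:E
      + (3 * eps)%:E * \int[mu]_(t in `[1%R, +oo[)
          (`|count_below u t - a * t| / t ^+ 2 * kernel R eps c t)%:E)%E.
Proof.
have e_gt0 := eps0; have a_ge0 := a0; have C_ge0 := C0.
have pu0 j : 0 <= pos_part c (u j) / u j.
  by rewrite divr_ge0 ?pos_part_ge0//; have := u1 j; lra.
have nu0 j : 0 <= neg_part c (u j) / u j.
  by rewrite divr_ge0 ?neg_part_ge0//; have := u1 j; lra.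
set P := (\sum_(j <oo) (pos_part c (u j) / u j)%:E)%E.
set Q := (\int[mu]_(t in _) _)%E.
have P0 : (0 <= P)%E by apply: nneseries_ge0 => j _ _; rewrite lee_fin.
have Q0 : (0 <= Q)%E.
  apply: integral_ge0 => t _; rewrite lee_fin.
  by apply/mulr_ge0/ltW/kernel_gt0; rewrite divr_ge0// sqr_ge0.
pose Phi t := - kernel R eps c t.
pose f t := dkernel R eps c t * t^-1.
pose f' t := - ((dkernel R eps c t + ddkernel R eps c t) * t^-1 * t^-1).
have dPhi (t : R) : 0 < t -> is_derive t 1 Phi (f t).
  move=> t0; have ? := is_derive_kernel R eps c t t0.
  by rewrite /Phi; apply: is_derive_eq; rewrite opprK.
have df (t : R) : 0 < t -> is_derive t 1 f (f' t).
  move=> t0; have ? := is_derive_dkernel R eps c t t0; have ? := dV _ t0.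
  by rewrite /f; apply: is_derive_eq; rewrite /GRing.scale/= /f'; field; rewrite gt_eqF.
have cf' (t : R) : 0 < t -> {for t, continuous f'}.
  move=> t0; apply: cvgN; apply: cvgM (cV _ t0); apply: cvgM (cV _ t0).
  exact: continuous_sum_dkernel.
pose h t := (`|count_below u t - a * t| / t ^+ 2 * kernel R eps c t).
have mh (D : set R) : measurable D -> (forall t, D t -> 0 < t) ->
    measurable_fun D (fun t => (h t)%:E).
  move=> mD D0; apply/measurable_EFinP; rewrite /h.
  apply: measurable_funM; last first.
    by apply: measurable_continuous_pos => // t; exact: continuous_kernel.
  apply: measurable_funM.
    apply: measurableT_comp => //; apply: measurable_funB.
      exact: measurable_count_below.
    exact: measurable_funM.
  apply: measurable_continuous_pos => // t t0.
  apply: (@is_derive_continuous _ _ _ (- 2 * t^-1 ^+ 3)).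
  rewrite (_ : (fun _ => _) = fun t : R => t^-1 * t^-1); last first.
    by apply/funext => x; rewrite -exprVn expr2.
  have ? := dV _ t0.
  by apply: is_derive_eq; rewrite /GRing.scale/=; field; rewrite gt_eqF.
have intf' X : 1 <= X ->
    (\int[mu]_(t in `[1%R, X]) (`|f' t| * `|count_below u t - a * t|)%:E
     <= (3 * eps)%:E * Q)%E.
  move=> X1.
  have mD : measurable (`[1, X]%classic : set R) by exact: measurable_itv.
  have mE : measurable (`[1, +oo[%classic : set R) by exact: measurable_itv.
  have D0 t : `[1, X]%classic t -> 0 < t by rewrite /= in_itv/= => /andP[t1 _]; lra.
  have E0 (t : R) : `[1, +oo[%classic t -> 0 < t by rewrite /= in_itv/= => /andP[t1 _]; lra.
  have h0 t : (0 <= (h t)%:E)%E.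
    by rewrite lee_fin; apply/mulr_ge0/ltW/kernel_gt0; rewrite divr_ge0// sqr_ge0.
  have e3 : 0 <= 3 * eps by lra.
  rewrite /Q -(@ge0_integralZl_EFin _ _ _ mu _ mE _ (fun t _ => h0 t) (mh _ mE E0) (3 * eps) e3).
  have mZ (D : set R) : measurable D -> (forall t, D t -> 0 < t) ->
      measurable_fun D (fun t => (3 * eps)%:E * (h t)%:E)%E.
    by move=> mD' D0'; apply: measurable_funeM; exact: mh.
  have hZ t : (0 <= (3 * eps)%:E * (h t)%:E)%E.
    by rewrite mule_ge0.
  apply: le_trans (ge0_subset_integral mu mD mE (mZ _ mE E0) (fun t _ => hZ t) _); last first.
    by move=> t /=; rewrite !in_itv/= => /andP[->].
  apply: ge0_le_integral => //.
  - apply: measurable_norm_mul => //.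
  - exact: mZ.
  - move=> t Dt; have t0 := D0 t Dt; rewrite -EFinM lee_fin /f' /h normrN !normrM.
    have V0 : 0 < t^-1 by rewrite invr_gt0.
    rewrite (gtr0_norm V0) (_ : 3 * eps * _ = 3 * (eps * kernel R eps c t) * t^-1 * t^-1 *
      `|count_below u t - a * t|); last by field; rewrite gt_eqF.
    rewrite ler_wpM2r// ler_wpM2r ?(ltW V0)// ler_wpM2r ?(ltW V0)//.
    exact: le_trans (ler_normD _ _) (norm_dkernel_ddkernel_le _ _).
have e3 : 0 <= 3 * eps by lra.
have ak0 : (0 <= (a * eps * kernel R eps c 1)%:E)%E.
  by rewrite lee_fin; apply/mulr_ge0/ltW/kernel_gt0/mulr_ge0/ltW.
have Q3 : (0 <= (3 * eps)%:E * Q)%E by rewrite mule_ge0.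
(* If [P] or [Q] is infinite, so is the right side; otherwise real arithmetic is available. *)
have [PE|Pfin] := eqVneq P +oo%E.
  rewrite -addeA PE [X in (_ <= X)%E]addye ?leey// gt_eqF//.
  by rewrite (lt_le_trans (ltNyr 0))// adde_ge0.
have [QE|Qfin] := eqVneq Q +oo%E.
  rewrite QE gt0_muley ?lte_fin ?mulr_gt0// addey ?leey// gt_eqF//.
  by rewrite (lt_le_trans (ltNyr 0))// adde_ge0.
have PE : P \is a fin_num by rewrite ge0_fin_numE// ltey.
have QE : Q \is a fin_num by rewrite ge0_fin_numE// ltey.
set rhs := fine P + a * eps * kernel R eps c 1 + 3 * eps * fine Q.
rewrite -(fineK PE) -(fineK QE) -EFinM -!EFinD -leeBrDl//.
apply: nneseries_EFin_le => // J0; rewrite lee_fin lerBrDl -/rhs.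
(* The terms left over at [X] amount to at most [(C + a) * kernel c X], which is below any [d > 0]
   for a distant cutoff; the added 1 keeps the divisor positive. *)
apply/ler_addgt0Pr => d d0.
have Ca : 0 < C + a + 1 by lra.
have [X0 kX0] := kernel_lt_exists c (d / (C + a + 1)) (divr_gt0 d0 Ca).
have [X [J [X0X X1 J0J uJ cJ]]] := count_below_exists R u und u1 uoo J0 X0.
have := abel_summation _ u a Phi f f' X J und u1 uoo uJ X1 dPhi df cf'.
move=> /le_trans/(_ (intf' X X1)); rewrite -(fineK QE) -EFinM lee_fin.
move=> /ler_normlP[+ _].
have X_gt0 : 0 < X by lra.
have k0 := kernel_gt0 R eps c X.
have fX : `|f X| <= kernel R eps c X / X.
  rewrite /f normrM (gtr0_norm (_ : 0 < X^-1)) ?invr_gt0// ler_pM2r ?invr_gt0//.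
  by apply: le_trans (norm_dkernel_le R eps eps0 c X) _; rewrite ler_piMl// ltW.
have E1 : - (C * kernel R eps c X) <= (J%:R - a * X) * f X.
  suff : `|(J%:R - a * X) * f X| <= C * kernel R eps c X by move=> /ler_normlP[]; lra.
  have := count_error_le R u a C C0 hC X X1; rewrite cJ => JX.
  rewrite normrM; apply: le_trans (ler_pM _ _ JX fX) _ => //.
  by rewrite le_eqVlt; apply/orP; left; apply/eqP; field; rewrite gt_eqF.
have E2 : - (eps * kernel R eps c 1) <= f 1.
  have := norm_dkernel_le R eps eps0 c 1 => /ler_normlP[].
  by rewrite /f invr1 mulr1; lra.
have E2' := ler_wpM2l a0 E2.
have E3 : (C + a) * kernel R eps c X <= d.
  have := kX0 X X0X; rewrite ltr_pdivlMr//; nra.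
have E4 : \sum_(j < J) f (u j) = \sum_(j < J) (pos_part c (u j) / u j)
    - \sum_(j < J) (neg_part c (u j) / u j).
  by rewrite -sumrB; apply: eq_bigr => j _; rewrite /f dkernelE mulrBl.
have E5 : \sum_(j < J) (pos_part c (u j) / u j) <= fine P.
  by rewrite -lee_fin fineK//; exact: (nneseries_EFin_ge _ (fun j => pos_part c (u j) / u j)).
have E6 := sum_ord_le _ (fun j => neg_part c (u j) / u j) _ _ J0J nu0.
rewrite E4 /Phi /rhs /= in E6 *.
by lra.
Qed.

(** The derivative of [f t = ln t * dkernel / t] costs a factor [1 + ln t], which the hypothesis on
    the counting error cancels. The integrand is then at most [3 * C * eps * kernel / t], the
    derivative of [- 3 * C * logistic], so the integral is at most [3 * C]. The boundary term at [X]
    gives [C], the main term [a / eps], and [f 1 = 0]. The constant is independent of [c]. *)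
Lemma log_kernel_sum_le (c : R) :
  (\sum_(j <oo) (ln (u j) * (pos_part c (u j) / u j))%:E
   <= \sum_(j <oo) (ln (u j) * (neg_part c (u j) / u j))%:E
      + (C + a / eps + 3 * C)%:E)%E.
Proof.
have e_gt0 := eps0; have a_ge0 := a0; have C_ge0 := C0.
have lu0 j : 0 <= ln (u j) by rewrite ln_ge0.
have pu0 j : 0 <= ln (u j) * (pos_part c (u j) / u j).
  by rewrite mulr_ge0// divr_ge0 ?pos_part_ge0//; have := u1 j; lra.
have nu0 j : 0 <= ln (u j) * (neg_part c (u j) / u j).
  by rewrite mulr_ge0// divr_ge0 ?neg_part_ge0//; have := u1 j; lra.
set P := (X in (_ <= X + _)%E).
apply: nneseries_EFin_le => // J0.
(* [f] has the bounded-above antiderivative [Phi] although it carries the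
   factor [ln t]. *)
pose Phi t := - (ln t * kernel R eps c t) - eps^-1 * logistic R eps c t.
pose f t := ln t * dkernel R eps c t * t^-1.
pose f' t := (dkernel R eps c t - ln t * (dkernel R eps c t + ddkernel R eps c t)) * t^-1 * t^-1.
pose g t := - (3 * C) * logistic R eps c t.
pose g' t := 3 * C * eps * (kernel R eps c t * t^-1).
have cln (t : R) : 0 < t -> {for t, continuous (@ln R)}.
  by move=> t0; exact: continuous_ln.
have dPhi (t : R) : 0 < t -> is_derive t 1 Phi (f t).
  move=> t0; have ? := is_derive_kernel R eps c t t0.
  have ? := is_derive_logistic R eps c t t0; have ? := is_derive1_ln t0.
  rewrite /Phi; apply: is_derive_eq; rewrite /GRing.scale/= /f.
  by field; rewrite !gt_eqF.
have df (t : R) : 0 < t -> is_derive t 1 f (f' t).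
  move=> t0; have ? := is_derive_dkernel R eps c t t0; have ? := dV _ t0.
  have ? := is_derive1_ln t0.
  by rewrite /f; apply: is_derive_eq; rewrite /GRing.scale/= /f'; field; rewrite gt_eqF.
have cf' (t : R) : 0 < t -> {for t, continuous f'}.
  move=> t0; apply: cvgM (cV _ t0); apply: cvgM (cV _ t0).
  apply: cvgB; first exact: continuous_dkernel.
  by apply: cvgM (cln _ t0) _; exact: continuous_sum_dkernel.
have dg (t : R) : 0 < t -> is_derive t 1 g (g' t).
  move=> t0; have ? := is_derive_logistic R eps c t t0.
  rewrite /g; apply: is_derive_eq; rewrite /GRing.scale/= /g'.
  by field; rewrite gt_eqF.
have cg' (t : R) : 0 < t -> {for t, continuous g'}.
  move=> t0; apply: cvgM; first exact: cvg_cst.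
  by apply: cvgM (cV _ t0); exact: continuous_kernel.
have fg t : 1 <= t -> `|f' t| * `|count_below u t - a * t| <= g' t.
  move=> t1; have t0 : 0 < t by lra.
  have lt0 := ln_ge0 t1; have V0 : 0 < t^-1 by rewrite invr_gt0.
  have k0 := kernel_gt0 R eps c t.
  apply: (@le_trans _ _ ((1 + ln t) * (3 * (eps * kernel R eps c t)) * t^-1 * t^-1 *
      (C * (t / (1 + ln t))))); last first.
    by rewrite le_eqVlt /g'; apply/orP; left; apply/eqP; field; rewrite !gt_eqF//; lra.
  apply: ler_pM (hC _ t1) => //.
  rewrite /f' !normrM (gtr0_norm V0) ler_wpM2r ?(ltW V0)// ler_wpM2r ?(ltW V0)//.
  apply: le_trans (ler_normB _ _) _; rewrite (normrM (ln t)) (ger0_norm lt0).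
  have := norm_dkernel_ddkernel_le c t.
  have := ler_normD (dkernel R eps c t) (ddkernel R eps c t).
  have := normr_ge0 (ddkernel R eps c t).
  by nra.
have [X [J [_ X1 J0J uJ cJ]]] := count_below_exists R u und u1 uoo J0 1.
have := abel_summation _ u a Phi f f' X J und u1 uoo uJ X1 dPhi df cf'.
move=> /le_trans/(_ (integral_error_le_is_derive R u a und uoo f' g g' X X1 cf' dg cg' fg)).
rewrite lee_fin => /ler_normlP[_ S].
have X_gt0 : 0 < X by lra.
have lX0 := ln_ge0 X1.
have k0 := kernel_gt0 R eps c X.
have E1 : (J%:R - a * X) * f X <= C.
  apply: (le_trans (ler_norm _)).
  have fX : `|f X| <= ln X / X.
    rewrite /f (normrM (ln X * _)) (normrM (ln X)) (gtr0_norm (_ : 0 < X^-1)) ?invr_gt0// ler_pM2r ?invr_gt0//.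
    rewrite (ger0_norm lX0) ler_piMr//.
    apply: le_trans (norm_dkernel_le R eps eps0 c X) _.
    exact: (mulr_ile1 (ltW eps0) (ltW k0) eps1 (kernel_le1 _ _ _ _)).
  have := hC _ X1; rewrite cJ normrM => JX.
  apply: le_trans (ler_pM _ _ JX fX) _ => //.
  rewrite -mulrA ler_piMr// (_ : _ / _ * _ = ln X / (1 + ln X)); last first.
    by field; rewrite !gt_eqF//; lra.
  by rewrite ler_pdivrMr; lra.
have f1 : f 1 = 0 by rewrite /f ln1 !mul0r.
have s1 := logistic_lt1 R eps c 1; have s0 := logistic_gt0 R eps c X.
have E2 : Phi X - Phi 1 <= eps^-1.
  rewrite /Phi ln1 mul0r oppr0 sub0r opprK.
  have := mulr_ge0 lX0 (ltW k0).
  have e0 : 0 < eps^-1 by rewrite invr_gt0.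
  have := mulr_ge0 (ltW e0) (ltW s0).
  have : eps^-1 * logistic R eps c 1 <= eps^-1 by rewrite ler_piMr ?(ltW e0) ?(ltW s1).
  by lra.
have E2' := ler_wpM2l a0 E2.
have E3 : g X - g 1 <= 3 * C by rewrite /g; nra.
have E4 : \sum_(j < J) f (u j) = \sum_(j < J) (ln (u j) * (pos_part c (u j) / u j))
    - \sum_(j < J) (ln (u j) * (neg_part c (u j) / u j)).
  by rewrite -sumrB; apply: eq_bigr => j _; rewrite /f dkernelE; ring.
have E6 := sum_ord_le _ (fun j => ln (u j) * (pos_part c (u j) / u j)) _ _ J0J pu0.
have E5 := nneseries_EFin_ge _ (fun j => ln (u j) * (neg_part c (u j) / u j)) J nu0.
apply: le_trans (leeD2r _ E5); rewrite -EFinD lee_fin.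
by move: S; rewrite E4 f1; rewrite /= in E6; lra.
Qed.

End KernelSums.

(** * Boundedness of the smoothed Chebyshev mean *)

Lemma norm_error_divE (R : realType) (x y : R) : 1 <= x ->
  `|y / x| / x = `|y| / x ^+ 2.
Proof.
by move=> x1; rewrite normrM normfV (ger0_norm (_ : 0 <= x)) -?mulrA -?invfM ?expr2//; lra.
Qed.

Section ChebyshevMean.
Variables (R : realType) (u lam q : nat -> R) (a C : R).
Hypotheses (und : nondecreasing_seq u) (u1 : forall j, 1 <= u j)
  (uoo : forall x, exists j, x <= u j) (u_eq1 : exists j, u j = 1).
Hypotheses (a0 : 0 < a) (C0 : 0 <= C)
  (hC : forall t, 1 <= t -> `|count_below u t - a * t| <= C * (t / (1 + ln t))).
Hypotheses (lam0 : forall i, 0 <= lam i) (q1 : forall i, 1 <= q i)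
  (convolution : forall F : R -> R, (forall x, 1 <= x -> 0 <= F x) ->
    (\sum_(i <oo) \sum_(j <oo) (lam i * F (q i * u j))%:E
     = \sum_(j <oo) (ln (u j) * F (u j))%:E)%E).

Let mu := (@lebesgue_measure R).

Let err t := `|count_below u t - a * t| / t ^+ 2.
Let errint := (\int[mu]_(t in `[1%R, +oo[) (err t)%:E)%E.

Let q0 i : 0 < q i. Proof. exact: lt_le_trans ltr01 (q1 i). Qed.
Let u0 i : 0 < u i. Proof. exact: lt_le_trans ltr01 (u1 i). Qed.

Let err0 t : 0 <= err t.
Proof. by rewrite divr_ge0// sqr_ge0. Qed.

Let measurable_err (D : set R) : measurable D -> (forall t, D t -> 0 < t) ->
  measurable_fun D err.
Proof.
move=> mD D0; apply: measurable_funM.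
  apply: measurableT_comp => //; apply: measurable_funB; last exact: measurable_funM.
  exact: measurable_count_below.
apply: measurable_continuous_pos => // t t0.
apply: (@continuous_comp _ _ _ (fun t : R => t ^+ 2) (fun x : R => x^-1)).
  exact: exprn_continuous.
by apply: inv_continuous; rewrite expf_neq0// gt_eqF.
Qed.

Section FixedScale.
Variable eps : R.
Hypotheses (eps0 : 0 < eps) (eps1 : eps <= 1).

Let k := kernel R eps.
(** The terms of the smoothed Chebyshev mean [M x] at [x = exp c]. *)
Definition mean_term (c : R) (i : nat) : R := lam i / q i * k c (q i).
Definition mean (c : R) : \bar R := (\sum_(i <oo) (mean_term c i)%:E)%E.

Lemma weight_ge0 i : 0 <= lam i / q i.
Proof. by rewrite divr_ge0// ltW. Qed.

Lemma mean_term_ge0 c i : 0 <= mean_term c i.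
Proof. by apply/mulr_ge0/ltW/kernel_gt0; exact: weight_ge0. Qed.

(** The bound [ln t <= (2 / eps) * t ^ (eps / 2)] spends half of the exponent on the logarithm; the
    other half still gives a convergent sum. *)
Lemma log_power_sum_lty :
  (\sum_(j <oo) (ln (u j) * (expR (- (eps * ln (u j))) / u j))%:E < +oo)%E.
Proof.
have e2 : 0 < eps / 2 by rewrite divr_gt0.
have [B HB] := sum_power_bounded R u a C und u1 uoo (ltW a0) C0 hC (eps / 2) e2.
apply: (@le_lt_trans _ _ (2 / eps * B)%:E); last exact: ltry.
have lnu j : ln (u j) * (expR (- (eps * ln (u j))) / u j) <=
    2 / eps * (expR (- (eps / 2 * ln (u j))) / u j).
  have V0 : 0 < (u j)^-1 by rewrite invr_gt0.
  rewrite !mulrA ler_pM2r//.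
  have -> : - (eps * ln (u j)) = - (eps / 2 * ln (u j)) + - (eps / 2 * ln (u j)) by field.
  rewrite expRD mulrA ler_pM2r ?expR_gt0//.
  have := expR_gt0 (eps / 2 * ln (u j)); have := expR_ge1Dx (eps / 2 * ln (u j)).
  rewrite expRN; set E := expR _ => E1 E0.
  by rewrite ler_pdivrMr// mulrAC ler_pdivlMr//; lra.
apply: nneseries_EFin_le => [j|J].
  rewrite mulr_ge0 ?ln_ge0// divr_ge0// ltW//; exact: expR_gt0.
rewrite lee_fin.
apply: (@le_trans _ _ (\sum_(j < J) 2 / eps * (expR (- (eps / 2 * ln (u j))) / u j))).
  by apply: ler_sum => j _; exact: lnu.
by rewrite -mulr_sumr ler_pM2l ?divr_gt0.
Qed.

(* Makes [mean] finite, so that its supremum over [c <= c0] can be absorbed. *)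
Lemma mean_le_exp : exists Z : R, 0 <= Z /\
  forall c, (mean c <= (expR (eps * c) * Z)%:E)%E.
Proof.
pose F t := expR (- (eps * ln t)) / t.
have F0 x : 1 <= x -> 0 <= F x.
  by move=> x1; rewrite divr_ge0 ?ltW ?expR_gt0//; lra.
have F0' x : 0 < x -> 0 <= F x by move=> x0; rewrite divr_ge0 ?ltW ?expR_gt0.
have term0 i : 0 <= lam i * F (q i) by rewrite mulr_ge0// F0.
pose S := (\sum_(i <oo) (lam i * F (q i))%:E)%E.
have Soo : (S < +oo)%E.
  apply: le_lt_trans log_power_sum_lty; rewrite -(convolution F F0).
  apply: lee_nneseries => [i _ _|i _]; first by rewrite lee_fin.
  (* Of the inner sum only the term with [u j = 1] is kept. *)
  have [j uj] := u_eq1; rewrite -[X in F X]mulr1 -uj.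
  rewrite (@nneseriesD1 _ _ j)//; last by move=> l _; rewrite lee_fin mulr_ge0// F0'// mulr_gt0.
  by rewrite leeDl// nneseries_ge0// => l _ _; rewrite lee_fin mulr_ge0// F0'// mulr_gt0.
have S0 : (0 <= S)%E by apply: nneseries_ge0 => i _ _; rewrite lee_fin.
have SE : S \is a fin_num by rewrite ge0_fin_numE.
exists (fine S); split=> [|c]; first exact: fine_ge0.
rewrite EFinM fineK// -nneseriesZl; last by move=> i _; rewrite lee_fin.
apply: lee_nneseries => [i _ _|i _]; first by rewrite lee_fin mean_term_ge0.
rewrite -EFinM lee_fin /mean_term /F.
apply: le_trans (ler_wpM2l (weight_ge0 i) (kernel_le_expR _ _ _ _)) _.
rewrite (_ : - (eps * (ln (q i) - c)) = eps * c + - (eps * ln (q i))); last by ring.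
by rewrite expRD le_eqVlt; apply/orP; left; apply/eqP; field; rewrite gt_eqF.
Qed.

Let shiftP c i t : 0 < t -> pos_part R eps (c - ln (q i)) t = pos_part R eps c (q i * t).
Proof. by move=> t0; rewrite /pos_part kernel_shift// logistic_shift. Qed.

Let shiftN c i t : 0 < t -> neg_part R eps (c - ln (q i)) t = neg_part R eps c (q i * t).
Proof. by move=> t0; rewrite /neg_part kernel_shift// logistic_shift. Qed.

(** Follows from the decay of [neg_part]; finiteness permits cancelling this sum in an inequality
    between extended reals. *)
Lemma neg_log_sum_lty c :
  (\sum_(j <oo) (ln (u j) * (neg_part R eps c (u j) / u j))%:E < +oo)%E.
Proof.
apply: (@le_lt_trans _ _ ((expR (eps * c))%:E *
    \sum_(j <oo) (ln (u j) * (expR (- (eps * ln (u j))) / u j))%:E)%E); last first.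
  by apply: lte_mul_pinfty => //; exact: log_power_sum_lty.
have w0 j : 0 <= expR (- (eps * ln (u j))) / u j by rewrite divr_ge0// ltW// expR_gt0.
rewrite -nneseriesZl; last by move=> j _; rewrite lee_fin mulr_ge0// ln_ge0.
apply: lee_nneseries => [j _ _|j _].
  rewrite lee_fin mulr_ge0 ?ln_ge0// divr_ge0 ?(ltW (u0 j))//; exact: neg_part_ge0.
rewrite -EFinM lee_fin [leRHS]mulrCA ler_wpM2l ?ln_ge0// mulrA ler_pM2r ?invr_gt0//.
exact: neg_part_le.
Qed.

(** The inequality [kernel_le_sum] at [c - ln (q i)], weighted by [lam i / q i], is summed over [i].
    The convolution identity turns both double sums into logarithmic sums, compared by
    [log_kernel_sum_le]; [s] bounds the means under the error integral. *)
Lemma mean_convolution_le (c s : R) : 0 <= s ->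
  (forall t, 1 <= t -> (mean (c - ln t) <= s%:E)%E) ->
  (a%:E * mean c <= (C + a / eps + 3 * C)%:E + (a * eps)%:E * s%:E
     + (3 * eps)%:E * (s%:E * errint))%E.
Proof.
move=> s0 Ms; have a_gt0 := a0; have e_gt0 := eps0.
pose Fp t := pos_part R eps c t / t; pose Fn t := neg_part R eps c t / t.
have Fp0 t : 0 < t -> 0 <= Fp t.
  by move=> t0; rewrite divr_ge0 ?(ltW t0)//; exact: pos_part_ge0.
have Fn0 t : 0 < t -> 0 <= Fn t.
  by move=> t0; rewrite divr_ge0 ?(ltW t0)//; exact: neg_part_ge0.
have mE : measurable (`[1, +oo[%classic : set R) by exact: measurable_itv.
have D0 (t : R) : `[1, +oo[%classic t -> 0 < t by rewrite /= in_itv/= => /andP[t1 _]; lra.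
pose h i t := err t * (lam i / q i * k c (q i * t)).
have h0 i t : (0 <= (h i t)%:E)%E.
  by rewrite lee_fin mulr_ge0//; apply/mulr_ge0/ltW/kernel_gt0; exact: weight_ge0.
have mh i : measurable_fun (`[1, +oo[%classic : set R) (fun t => (h i t)%:E).
  apply/measurable_EFinP; apply: measurable_funM; first exact: measurable_err.
  apply: measurable_funM => //; apply: measurable_continuous_pos => // t t0.
  apply: (@continuous_comp _ _ _ (fun t : R => q i * t) (k c)).
    by apply: cvgM; [exact: cvg_cst | exact: cvg_id].
  by apply: continuous_kernel; rewrite mulr_gt0.
pose P i := (\sum_(j <oo) (lam i * Fp (q i * u j))%:E)%E.
pose N i := (\sum_(j <oo) (lam i * Fn (q i * u j))%:E)%E.
pose T i := ((3 * eps)%:E * \int[mu]_(t in `[1%R, +oo[) (h i t)%:E)%E.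
have P0 i : (0 <= P i)%E.
  by apply: nneseries_ge0 => j _ _; rewrite lee_fin mulr_ge0// Fp0// mulr_gt0.
have N0 i : (0 <= N i)%E.
  by apply: nneseries_ge0 => j _ _; rewrite lee_fin mulr_ge0// Fn0// mulr_gt0.
have I0 i : (0 <= \int[mu]_(t in `[1%R, +oo[) (h i t)%:E)%E by apply: integral_ge0 => t _.
have e3 : 0 <= 3 * eps by lra.
have T0 i : (0 <= T i)%E by rewrite mule_ge0.
have am0 i : (0 <= (a * mean_term c i)%:E)%E.
  by rewrite lee_fin mulr_ge0 ?mean_term_ge0// ltW.
have aem0 i : (0 <= (a * eps * mean_term c i)%:E)%E.
  by rewrite lee_fin mulr_ge0 ?mean_term_ge0// mulr_ge0// ltW.
(* The shift turns [t] into [q i * t] inside the kernel, and the weight completes [1 / u j] to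
   [lam i / (q i * u j)]. *)
have LA i : ((a * mean_term c i)%:E + N i <= P i + (a * eps * mean_term c i)%:E + T i)%E.
  have := kernel_le_sum R u a C eps und u1 uoo (ltW a0) C0 hC eps0 eps1 (c - ln (q i)).
  have wi0 : (0 <= (lam i / q i)%:E)%E by rewrite lee_fin weight_ge0.
  move=> /(lee_wpmul2l wi0).
  have pu0 j : (0 <= (pos_part R eps (c - ln (q i)) (u j) / u j)%:E)%E.
    rewrite lee_fin divr_ge0 ?(ltW (u0 j))//; exact: pos_part_ge0.
  have nu0 j : (0 <= (neg_part R eps (c - ln (q i)) (u j) / u j)%:E)%E.
    rewrite lee_fin divr_ge0 ?(ltW (u0 j))//; exact: neg_part_ge0.
  have k0 c' t : 0 <= kernel R eps c' t by rewrite ltW// kernel_gt0.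
  have J0 t : (0 <= (err t * kernel R eps (c - ln (q i)) t)%:E)%E.
    by rewrite lee_fin; apply/mulr_ge0/k0.
  have aek0 c' t : (0 <= (a * eps * kernel R eps c' t)%:E)%E.
    by rewrite lee_fin; apply/mulr_ge0/k0; apply: mulr_ge0; exact: ltW.
  have ak0 c' t : (0 <= (a * kernel R eps c' t)%:E)%E.
    by rewrite lee_fin; apply/mulr_ge0/k0; exact: ltW.
  have JJ0 : (0 <= \int[mu]_(t in `[1%R, +oo[) (err t * kernel R eps (c - ln (q i)) t)%:E)%E.
    by apply: integral_ge0 => t _.
  rewrite (ge0_muleDr _ (ak0 _ _) (nneseries_ge0 (fun j _ _ => nu0 j))).
  rewrite (ge0_muleDr _ (adde_ge0 (nneseries_ge0 (fun j _ _ => pu0 j)) (aek0 _ _)) (mule_ge0 (_ : 0 <= (3 * eps)%:E)%E JJ0))//.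
  rewrite (ge0_muleDr _ (nneseries_ge0 (fun j _ _ => pu0 j)) (aek0 _ _)).
  have shK t : 0 < t -> kernel R eps (c - ln (q i)) t = k c (q i * t).
    by move=> t0; rewrite kernel_shift.
  congr (_ <= _)%E.
  - congr (_ + _)%E.
      by rewrite -EFinM shK// mulr1 /mean_term; congr _%:E; ring.
    rewrite -nneseriesZl//; apply: eq_eseriesr => j _; rewrite -EFinM shiftN//.
    by congr _%:E; rewrite /Fn; field; rewrite !gt_eqF.
  - congr (_ + _ + _)%E.
    + rewrite -nneseriesZl//; apply: eq_eseriesr => j _; rewrite -EFinM shiftP//.
      by congr _%:E; rewrite /Fp; field; rewrite !gt_eqF.
    + by rewrite -EFinM shK// mulr1 /mean_term; congr _%:E; ring.
    rewrite muleCA; congr (_ * _)%E.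
    rewrite -(@ge0_integralZl_EFin _ _ _ mu _ mE _ (fun t _ => J0 t)) ?weight_ge0//; last first.
      apply/measurable_EFinP; apply: measurable_funM; first exact: measurable_err.
      by apply: measurable_continuous_pos => // t; exact: continuous_kernel.
    apply: eq_integral => t; rewrite inE => /D0 t0.
    by rewrite -EFinM shK// /h; congr _%:E; ring.
have sumLA : (a%:E * mean c + \sum_(i <oo) N i <=
    \sum_(i <oo) P i + (a * eps)%:E * mean c + \sum_(i <oo) T i)%E.
  have meanZ (x : R) : (x%:E * mean c = \sum_(i <oo) (x * mean_term c i)%:E)%E.
    by rewrite -nneseriesZl// => i _; rewrite lee_fin mean_term_ge0.
  rewrite !meanZ -!nneseriesD//; last by move=> i _ _; rewrite adde_ge0.
  by apply: lee_nneseries => [i _ _|i _]; [rewrite adde_ge0|exact: LA].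
have errE0 t : (0 <= (err t)%:E)%E by rewrite lee_fin.
(* Exchanging sum and integral leaves [err t * mean (c - ln t)] in the integrand, to which the
   hypothesis on [s] applies. *)
have sumT : (\sum_(i <oo) T i <= (3 * eps)%:E * (s%:E * errint))%E.
  rewrite nneseriesZl// lee_wpmul2l// -integral_nneseries//.
  rewrite -(@ge0_integralZl_EFin _ _ _ mu _ mE _ (fun t _ => errE0 t))//; last first.
    by apply/measurable_EFinP; exact: measurable_err.
  apply: ge0_le_integral => //.
  - by move=> t _; apply: nneseries_ge0.
  - exact: (@ge0_emeasurable_sum _ _ _ _ (fun i t => (h i t)%:E) xpredT).
  - apply: measurable_funeM; apply/measurable_EFinP; exact: measurable_err.
  - move=> t; rewrite /= in_itv/= => /andP[t1 _].
    have t0 : 0 < t by lra.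
    apply: le_trans (_ : (err t)%:E * mean (c - ln t) <= _)%E; last first.
      by rewrite muleC lee_wpmul2r ?lee_fin ?err0// Ms.
    rewrite -nneseriesZl; last by move=> i _; rewrite lee_fin mean_term_ge0.
    apply: lee_nneseries => // i _; rewrite -EFinM lee_fin /h /mean_term /k.
    by rewrite kernel_shift// mulrC [t * _]mulrC mulrC.
have Mc : (mean c <= s%:E)%E by have := Ms 1 (lexx 1); rewrite ln1 subr0.
have NE : (\sum_(i <oo) N i = \sum_(j <oo) (ln (u j) * Fn (u j))%:E)%E.
  by apply: convolution => x x1; rewrite Fn0//; lra.
have PE : (\sum_(i <oo) P i = \sum_(j <oo) (ln (u j) * Fp (u j))%:E)%E.
  by apply: convolution => x x1; rewrite Fp0//; lra.
have NT : (\sum_(i <oo) N i \is a fin_num)%E.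
  by rewrite ge0_fin_numE ?nneseries_ge0// NE; exact: neg_log_sum_lty.
have PN : (\sum_(i <oo) P i <= \sum_(i <oo) N i + (C + a / eps + 3 * C)%:E)%E.
  rewrite NE PE.
  exact: (log_kernel_sum_le R u a C eps und u1 uoo (ltW a0) C0 hC eps0 eps1 c).
rewrite -(leeD2lE _ _ NT) addeC; apply: (le_trans sumLA).
rewrite !addeA; apply: leeD => //; apply: leeD => //.
by rewrite lee_wpmul2l// lee_fin mulr_ge0// ltW.
Qed.

End FixedScale.
(** For the supremum [S] of the means up to [c0], the convolution estimate gives
    [a * S <= CB + eps * (a + 3 * I) * S]. The choice of [eps] makes the last coefficient [a / 2],
    whence [S <= 2 * CB / a], uniformly in [c0]. *)
Lemma mean_bounded : (errint < +oo)%E ->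
  exists eps K : R, [/\ 0 < eps, eps <= 1, 0 <= K & forall c, (mean eps c <= K%:E)%E].
Proof.
move=> Ioo; have a_gt0 := a0; have C_ge0 := C0.
have I0 : (0 <= errint)%E by apply: integral_ge0 => t _; rewrite lee_fin.
have IE : errint \is a fin_num by rewrite ge0_fin_numE.
set I := fine errint; have I_ge0 : 0 <= I by exact: fine_ge0.
pose eps := a / (2 * (a + 3 * I)).
have D0 : 0 < 2 * (a + 3 * I) by lra.
have eps0 : 0 < eps by rewrite divr_gt0.
have eps1 : eps <= 1 by rewrite ler_pdivrMr//; lra.
have epsE : eps * (a + 3 * I) = a / 2 by rewrite /eps; field; rewrite gt_eqF//; lra.
pose CB := C + a / eps + 3 * C.
have CB0 : 0 <= CB by rewrite !addr_ge0// ?mulr_ge0// ltW// invr_gt0.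
have K0 : 0 <= 2 * CB / a by rewrite divr_ge0 ?mulr_ge0// ltW.
exists eps, (2 * CB / a); split => // c0.
have [Z [Z0 HZ]] := mean_le_exp eps eps0.
have mean0 c : (0 <= mean eps c)%E.
  by apply: nneseries_ge0 => i _ _; rewrite lee_fin mean_term_ge0.
(* The range [c <= c0] is stable under subtracting [ln t] for [t >= 1], and the exponential bound
   makes this supremum finite. *)
pose S := ereal_sup [set mean eps c | c in [set c | c <= c0]].
have leS c : c <= c0 -> (mean eps c <= S)%E.
  by move=> cc0; apply: ereal_sup_ubound; exists c.
have SZ : (S <= (expR (eps * c0) * Z)%:E)%E.
  apply: ge_ereal_sup => _ [c /= cc0 <-]; apply: (le_trans (HZ c)).
  by rewrite lee_fin ler_wpM2r// ler_expR ler_wpM2l// ltW.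
have S0 : (0 <= S)%E by exact: le_trans (leS _ (lexx c0)).
have SE : S \is a fin_num by rewrite ge0_fin_numE// (le_lt_trans SZ)// ltry.
have s0 : 0 <= fine S by exact: fine_ge0.
have sup_le : (S <= ((CB + a / 2 * fine S) / a)%:E)%E.
  apply: ge_ereal_sup => _ [c /= cc0 <-].
  have lec t : 1 <= t -> (mean eps (c - ln t) <= (fine S)%:E)%E.
    by move=> /ln_ge0 lt0; rewrite fineK// leS//; lra.
  have := mean_convolution_le eps eps0 eps1 c (fine S) s0 lec.
  have mE : mean eps c \is a fin_num.
    by rewrite ge0_fin_numE// (le_lt_trans (leS _ cc0))// ltey_eq SE.
  rewrite -(fineK IE) -(fineK mE) -!EFinM -!EFinD !lee_fin -/I -/CB => H.
  rewrite ler_pdivlMr// mulrC -epsE; apply: (le_trans H).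
  by rewrite le_eqVlt; apply/orP; left; apply/eqP; ring.
apply: (le_trans (leS _ (lexx c0))); move: sup_le; rewrite -(fineK SE) !lee_fin.
by rewrite !ler_pdivlMr//; lra.
Qed.

End ChebyshevMean.

(** * From the mean to the prime counting function *)

(** Dropping the terms outside the range of [g] passes from prime powers to primes. *)
Lemma nneseries_injective_le (R : realType) (g : nat -> nat) (m : nat -> R) :
  injective g -> (forall i, 0 <= m i) ->
  (\sum_(k <oo) (m (g k))%:E <= \sum_(i <oo) (m i)%:E)%E.
Proof.
move=> ginj m0; rewrite !nneseries_esumT; try by move=> i; rewrite lee_fin.
have gbij : set_bij [set: nat] (range g) g.
  by split => [i _|i j _ _|//]; [exists i | exact: ginj].
rewrite -(reindex_esum _ _ _ (fun i => (m i)%:E) gbij) esum_mkcond.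
by apply: le_esum => i _; case: ifP => // _; rewrite lee_fin.
Qed.

(** Writing [1 + ln t] makes the estimate meaningful from [t = 1] on. Above the threshold [T >= e]
    one has [1 + ln t <= 2 * ln t]; below it the error is at most [B], while [t / (1 + ln t)] is at
    least [1 / (1 + ln T)]. *)
Lemma count_error_of_bigO (R : realType) (u : nat -> R) (a : R) :
  nondecreasing_seq u -> (forall x, exists j, x <= u j) -> 0 <= a ->
  (exists C0 X0 : R, 0 < C0 /\
    forall x, X0 < x -> `|count_below u x - a * x| <= C0 * `|x / ln x|) ->
  exists C : R, 0 <= C /\
    forall t, 1 <= t -> `|count_below u t - a * t| <= C * (t / (1 + ln t)).
Proof.
move=> und uoo a0 [C0 [X0 [C0_gt0 HC]]].
pose T := Num.max (X0 + 1) (expR 1).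
have TX : X0 < T by apply: lt_le_trans (_ : X0 + 1 <= T); [lra | rewrite le_max lexx].
have Te : expR 1 <= T by rewrite le_max lexx orbT.
have T0 : 0 < T by apply: lt_le_trans Te; exact: expR_gt0.
have lT : 1 <= ln T by rewrite -ler_expR lnK ?posrE.
have [J [uJ cJ]] := count_belowE _ u T und (uoo T).
pose B := J%:R + a * T; have B0 : 0 <= B by rewrite addr_ge0// mulr_ge0// ltW.
have C2 : 0 <= B * (1 + ln T) by rewrite mulr_ge0//; lra.
exists (2 * C0 + B * (1 + ln T)); split=> [|t t1]; first by lra.
have t0 : 0 < t by lra.
have lt0 := ln_ge0 t1.
have r0 : 0 <= t / (1 + ln t) by rewrite divr_ge0//; lra.
rewrite mulrDl; have [tT|Tt] := ltP t T.
  apply: (@le_trans _ _ B).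
    have [K [uK cK]] := count_belowE _ u t und (uoo t).
    have KJ : (K <= J)%N.
      rewrite leqNgt; apply/negP; rewrite -uK => uJt.
      by have := lt_trans uJt tT; rewrite uJ ltnn.
    rewrite cK; apply: le_trans (ler_normB _ _) _.
    rewrite normr_nat (ger0_norm (mulr_ge0 a0 (ltW t0))) lerD ?ler_nat//.
    by rewrite ler_wpM2l// ltW.
  have ltT : ln t <= ln T by rewrite ler_ln ?posrE// ltW.
  have : B <= B * (1 + ln T) * (t / (1 + ln t)).
    rewrite -mulrA ler_peMr// mulrA ler_pdivlMr ?mul1r; last by lra.
    by nra.
  have : 0 <= 2 * C0 * (t / (1 + ln t)) by rewrite mulr_ge0//; lra.
  lra.
have X0t : X0 < t by exact: lt_le_trans TX Tt.
have lt1 : 1 <= ln t by apply: (le_trans lT); rewrite ler_ln ?posrE.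
apply: (le_trans (HC _ X0t)).
rewrite ger0_norm; last by rewrite divr_ge0//; lra.
have : t / ln t <= 2 * (t / (1 + ln t)).
  rewrite ler_pdivrMr; last by lra.
  rewrite mulrAC mulrA ler_pdivlMr; last by lra.
  by nra.
have : 0 <= B * (1 + ln T) * (t / (1 + ln t)) by rewrite mulr_ge0.
by nra.
Qed.

Section PrimeCount.
Variables (R : realType) (p : nat -> R) (K : R).
Hypotheses (hp : beurling_primes p) (K0 : 0 <= K)
  (theta : forall (x : R) (J : nat), 0 < x -> (forall k, (k < J)%N -> p k < x) ->
     \sum_(k < J) ln (p k) <= K * x).

(** Primes from [y = sqrt x] on each contribute at least [ln y = ln x / 2] to the theta sum, which
    gives [2 * K]. Those below [y] number at most [K * y / ln (p 0)], and [ln y <= y] bounds their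
    share by [2 * K / ln (p 0)]. *)
Lemma prime_count_le (x : R) : 1 < x ->
  count_below p x * ln x / x <= 2 * K + 2 * K / ln (p 0%N).
Proof.
move=> x1; have K_ge0 := K0; have [_ pnd _] := hp; have poo := beurling_prime_unbounded _ _ hp.
have lp0 : 0 < ln (p 0%N) by rewrite ln_gt0// (beurling_prime_gt1 _ _ hp).
pose y := Num.sqrt x.
have x0 : 0 < x by lra.
have y0 : 0 < y by rewrite sqrtr_gt0.
have yy : x = y ^+ 2 by rewrite sqr_sqrtr// ltW.
have lxy : ln x = 2 * ln y by rewrite yy lnXn// mulr_natl.
have lx0 : 0 < ln x by exact: ln_gt0.
have ly0 : 0 < ln y by lra.
have ly := ln_sublinear y0.
have [J [pJ ->]] := count_belowE _ p x pnd (poo x).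
have [I [pI _]] := count_belowE _ p y pnd (poo y).
have tJ : \sum_(k < J) ln (p k) <= K * x by apply: theta => // k; rewrite pJ.
have tI : \sum_(k < I) ln (p k) <= K * y by apply: theta => // k; rewrite pI.
have I_le : I%:R * ln (p 0%N) <= K * y.
  apply: le_trans tI; rewrite mulr_natl -[X in _ *+ X]card_ord -sumr_const.
  apply: ler_sum => k _; rewrite ler_ln ?posrE ?(beurling_prime_gt0 _ _ hp)//.
  exact: pnd.
have J_le : J%:R * ln y <= K * x + I%:R * ln y.
  rewrite -lerBlDr -mulrBl; apply: le_trans tJ.
  apply: (@le_trans _ _ (\sum_(k < J) (I <= k)%N%:R * ln y)).
    rewrite -mulr_suml ler_pM2r// lerBlDr -natr_sum -natrD ler_nat.
    elim: (J) => [|j IH] //; rewrite big_ord_recr /=.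
    case: (leqP I j) => Ij; first by rewrite addn1 addSn ltnS.
    by rewrite addn0 (leq_trans Ij)// leq_addl.
  apply: ler_sum => k _; case: (leqP I k) => Ik; last first.
    by rewrite mul0r ln_ge0// ltW// (beurling_prime_gt1 _ _ hp).
  rewrite mul1r ler_ln ?posrE ?(beurling_prime_gt0 _ _ hp)//.
  by rewrite leNgt pI -leqNgt.
have I_ly : I%:R * ln y <= K * x / ln (p 0%N).
  apply: (@le_trans _ _ (K * y / ln (p 0%N) * y)).
    by rewrite ler_pM ?(ltW ly0) ?(ltW ly)// ler_pdivlMr.
  by rewrite yy le_eqVlt; apply/orP; left; apply/eqP; ring.
rewrite ler_pdivrMr// lxy.
have -> : (2 * K + 2 * K / ln (p 0%N)) * x = 2 * (K * x + K * x / ln (p 0%N)).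
  by field; rewrite gt_eqF.
by rewrite mulrCA ler_pM2l// (le_trans J_le)// lerD2l.
Qed.

End PrimeCount.

Theorem theorem1 (R : realType) (p n : nat -> R) (a : R)
  (hp : beurling_primes p) (hn : generalized_integers p n) (ha : 0 < a)
  (hint : (\int[lebesgue_measure]_(x in `[1%R : R, +oo[)
             (`|(count_below n x - a * x) / x| / x)%:E < +oo)%E)
  (hO : forall x : R, count_below n x = a * x +O_(x \near +oo_R) (x / ln x)) :
  (limf_esup (fun x : R => (count_below p x * ln x / x)%:E) +oo_R < +oo)%E.
Proof.
have n1 := beurling_integer_ge1 _ _ hp _ hn.
have noo := beurling_integer_unbounded _ _ hp _ hn.
have [nnd _] := hn.
have [C [C0 hC]] := count_error_of_bigO _ _ a nnd noo (ltW ha) (bigO_pinfty_bound _ _ _ _ hO).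
have [lam [q [lam0 q1 conv [g [ginj qg lamg]]]]] := beurling_von_mangoldt _ _ _ hp hn.
have Ioo : (\int[lebesgue_measure]_(t in `[1%R : R, +oo[)
    (`|count_below n t - a * t| / t ^+ 2)%:E < +oo)%E.
  apply: le_lt_trans hint; rewrite le_eqVlt; apply/orP; left; apply/eqP.
  apply: eq_integral => t; rewrite inE/= in_itv/= => /andP[t1 _].
  by rewrite norm_error_divE.
have [eps [K [eps0 eps1 K0 HK]]] := mean_bounded R n lam q a C nnd n1 noo
  (beurling_integer_eq1 _ _ _ hn) ha C0 hC lam0 q1 conv Ioo.
(* Only primes below [x] are kept in the mean at [c = ln x]; each has kernel value at least
   [p k / (4 * x)], so the bound [K] on the mean becomes [4 * K * x] for the theta sum. *)
have theta (x : R) (J : nat) : 0 < x -> (forall k, (k < J)%N -> p k < x) ->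
    \sum_(k < J) ln (p k) <= 4 * K * x.
  move=> x0 px; have m0 := mean_term_ge0 R lam q lam0 q1 eps (ln x).
  have : \sum_(k < J) mean_term R lam q eps (ln x) (g k) <= K.
    rewrite -lee_fin; apply: le_trans (HK (ln x)).
    apply: le_trans (nneseries_injective_le _ _ _ ginj m0).
    exact: (nneseries_EFin_ge _ (fun k => mean_term R lam q eps (ln x) (g k))).
  rewrite -(ler_pM2l (_ : 0 < 4 * x)) ?mulr_gt0// [leRHS]mulrAC; apply: le_trans.
  rewrite mulr_sumr; apply: ler_sum => k _; rewrite /mean_term qg lamg.
  have pk1 := beurling_prime_gt1 _ _ hp k; have pk0 : 0 < p k by lra.
  have pkx := px _ (ltn_ord k).
  have lpx : ln (p k) <= ln x by rewrite ler_ln ?posrE// ltW.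
  have lp0 : 0 <= ln (p k) by rewrite ln_ge0// ltW.
  (* As [p k / x <= 1] and [eps <= 1], the quotient is at most its own power with exponent [eps]. *)
  have : p k / x <= 4 * kernel R eps (ln x) (p k).
    apply: le_trans (kernel_ge_expR _ _ _ _ eps0 lpx).
    rewrite -[leLHS]lnK ?posrE ?divr_gt0// ler_expR ln_div ?posrE//; nra.
  rewrite ler_pdivrMr// => kx.
  apply: (@le_trans _ _ (ln (p k) / p k * p k)); first by rewrite divfK// gt_eqF.
  rewrite [leRHS](_ : _ = ln (p k) / p k * (4 * kernel R eps (ln x) (p k) * x)); last by ring.
  by rewrite ler_wpM2l// divr_ge0// ltW.
apply: (@ereal_limf_esup_pinfty_lt _ _ (2 * (4 * K) + 2 * (4 * K) / ln (p 0%N)) 1) => x x1.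
by apply: prime_count_le => //; rewrite mulr_ge0.
Qed.
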